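(* Let $K\subset\mathbb{R}$ be a totally real number field of degree $d\geq 2$, with ring of integers $\mathbb{Z}_K$, and let $\sigma_2,\dots,\sigma_d$ be the embeddings of $K$ into $\mathbb{R}$ other than the identity. Let $\wp_K$ be the set of Pisot numbers $\theta\in K$ with $\mathbb{Q}(\theta)=K$, enumerated $\theta_1<\theta_2<\cdots$. Define $$D_K:=\{\theta_n-\theta_m\mid n>m\geq 1\},\qquad \mathcal{F}_K:=\{\theta_{n+1}-\theta_n\mid n\in\mathbb{N}\},$$ $$E_K:=\{\beta\in\mathbb{Z}_K\cap(0,\infty)\mid (|\sigma_2(\beta)|,\dots,|\sigma_d(\beta)|)\in(0,2)^{d-1}\},$$ let $U_K$ be the set of root of unity trace numbers lying in $K$, and let $d_1<d_2<\cdots$ be the elements of $\mathcal{F}_K$ and $u_1<u_2<\cdots$ the elements of $U_K$. Then: (i) $D_K=E_K$; (ii) $U_K=E_K\cap(0,2)=D_K\cap(0,2)$; (iii) the sets $T_K:=E_K\cap(2,\infty)=D_K\cap(2,\infty)$ and $U_K$ form a partition of $D_K$, and every element of $T_K$ has degree $d$; (iv) $\mathrm{card}(\mathcal{F}_K)\geq 2^{d-1}$; (v) $\mathcal{F}_K\cap(0,2)\subset U_K$, $d_1=u_1\leq 1$, and $d_2=u_2$ whenever $\mathrm{card}(U_K)\geq 2$; (vi) if $\mathrm{card}(U_K)=1$, then $d_1=1$ and $d_2=\min T_K$, and $\min T_K$ is the smallest Salem trace number of degree $d$ lying in $K$.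
   Context: A Pisot number is a real algebraic integer $>1$ whose other conjugates have modulus $<1$. A Salem number is a real algebraic integer $\tau>1$ whose other conjugates have modulus at most $1$, with at least one of modulus exactly $1$; a Salem trace number is a number of the form $\tau+\tau^{-1}$ with $\tau$ a Salem number. A root of unity trace number is a positive algebraic integer of the form $2\cos(2k\pi/n)$ with $n\geq 4$ an integer, $k\in\{1,\dots,n-1\}$ and $\gcd(k,n)=1$. The set $\wp_K$ is infinite and discrete in $[1,\infty)$, and $\mathcal{F}_K$ and $U_K$ are finite. Degrees are over $\mathbb{Q}$. *)

(* Defs.v *)
From HB Require Import structures.
From mathcomp Require Import all_boot all_order all_algebra all_field.
Set Implicit Arguments.
Unset Strict Implicit.
Unset Printing Implicit Defensive.
Import Order.TTheory GRing.Theory Num.Theory.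
Local Open Scope ring_scope.

Definition conjugate (x y : algC) : Prop := root (minCpoly x) y.

Definition Pisot (x : algC) : Prop :=
  [/\ x \is Num.real, x \in Aint, 1 < x &
      forall y, conjugate x y -> y != x -> `|y| < 1].

Definition Salem (t : algC) : Prop :=
  [/\ t \is Num.real, t \in Aint, 1 < t,
      (forall y, conjugate t y -> y != t -> `|y| <= 1) &
      exists y, [/\ conjugate t y, y != t & `|y| = 1] ].

Definition Salem_trace (x : algC) : Prop := exists t, Salem t /\ x = t + t^-1.

(* root of unity trace number: positive algebraic integer 2cos(2k pi/n),
   n >= 4, gcd(k,n)=1, written as z + z^-1 with z = exp(2 i k pi / n)
   a primitive n-th root of unity *)
Definition rut_number (x : algC) : Prop :=
  [/\ x \in Aint, 0 < x &
      exists n : nat, (4 <= n)%N /\ exists z : algC, n.-primitive_root z /\ x = z + z^-1].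

Section NumberField.
Variables (L : fieldExtType rat) (iota : {rmorphism L -> algC}).
(* L is the number field K, iota its given real embedding (the identity K ⊂ R) *)

Definition other_emb (s : {rmorphism L -> algC}) : Prop := exists x : L, s x != iota x.

Definition PisotK (t : L) : Prop := Pisot (iota t) /\ <<1%VS; t>>%VS = fullv.

Definition DK (x : L) : Prop :=
  exists a b, [/\ PisotK a, PisotK b, iota b < iota a & x = a - b].

Definition FK (x : L) : Prop :=
  exists a b, [/\ PisotK a, PisotK b, iota b < iota a, x = a - b &
    forall c, PisotK c -> ~ (iota b < iota c /\ iota c < iota a)].

Definition ZK (x : L) : Prop := iota x \in Aint.

Definition EK (b : L) : Prop :=
  [/\ ZK b, 0 < iota b &
      forall s : {rmorphism L -> algC}, other_emb s -> 0 < `|s b| < 2].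

Definition UK (x : L) : Prop := rut_number (iota x).

Definition TK (x : L) : Prop := EK x /\ 2 < iota x.

Definition degK (x : L) : nat := adjoin_degree 1%AS x.

(* x is the (k+1)-th smallest element of P (index k counted from 0):
   exactly k elements of P are smaller than x *)
Definition rank_in (P : L -> Prop) (x : L) (k : nat) : Prop :=
  P x /\ exists s : seq L, [/\ uniq s, size s = k &
                               forall y, y \in s <-> (P y /\ iota y < iota x)].

Definition is_min (P : L -> Prop) (x : L) : Prop :=
  P x /\ forall y, P y -> iota x <= iota y.

End NumberField.

(* Main.v *)
(** A Pisot generator of the field is exactly an integer greater than 1 whose other embeddings
    lie in (-1,1), so a difference of two of them lies in E_K.  Conversely Z_K is dense in the
    coordinates other than the identity: a pigeonhole argument gives a nonzero integer that is
    small in those coordinates, and multiplying the lattice by it makes rounding harmless.  Hence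
    every element of E_K joins two Pisot numbers.  Elements of Z_K bounded in all embeddings are
    finite in number, which gives Kronecker's theorem (U_K = E_K on (0,2)) and minima.  An element
    of E_K that is not a sum of two others is a gap; this settles the smallest two elements,
    since v = u + u below 2 would make all embeddings of u smaller than 1.  For the count of gaps,
    a Pisot number whose conjugates are close to a vertex of the cube [-1,1]^(d-1) is followed by
    a gap with the opposite sign vector.  Finally, the elements of T_K are t + 1/t for the Salem
    numbers t obtained from 'X^2 - b 'X + 1. *)
Require Import Defs.
From HB Require Import structures.
From mathcomp Require Import all_boot all_order all_algebra all_field.
From mathcomp Require Import ring lra zify.
Set Implicit Arguments.
Unset Strict Implicit.
Unset Printing Implicit Defensive.
Import Order.TTheory GRing.Theory Num.Theory.
Local Open Scope ring_scope.

(** * Embeddings *)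

(** Let [a] clear the denominators of the minimal polynomial, of degree [m]. Multiplying its
    coefficient of index [i] by [a ^ (m - i)] gives a monic polynomial with integral coefficients
    that has [a x] as a root. *)
Lemma Aint_multiple (x : algC) :
  exists2 D : int, D != 0 & D%:~R * x \in Aint.
Proof.
have [p [Dp mon_p] _] := minCpolyP x.
have [q [a a0 Dq]] := rat_poly_scale p.
exists a => //.
have px : root (minCpoly x) x by apply: root_minCpoly.
set m := (size p).-1.
have sp : size p = m.+1 by rewrite prednK // size_poly_gt0 monic_neq0.
pose A : algC := a%:~R.
pose r : {poly algC} := \poly_(i < m.+1) ((minCpoly x)`_i * A ^+ (m - i)).
have lead1 : (minCpoly x)`_m = 1.
  have := minCpoly_monic x; rewrite monicE lead_coefE Dp size_map_poly.
  by move/eqP.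
have sr : size r = m.+1 by rewrite size_poly_eq // subnn expr0 mulr1 lead1 oner_eq0.
apply: (@root_monic_Aint r).
- rewrite /root horner_poly.
  have := px; rewrite /root horner_coef Dp size_map_poly sp -Dp => /eqP e0.
  rewrite (eq_bigr (fun i : 'I_m.+1 => A ^+ m * ((minCpoly x)`_i * x ^+ i))).
    by rewrite -mulr_sumr e0 mulr0.
  move=> i _; have := ltn_ord i; rewrite ltnS => im.
  have -> : A ^+ m = A ^+ (m - i) * A ^+ i by rewrite -exprD subnK.
  by rewrite exprMn; ring.
- by rewrite monicE lead_coefE sr coef_poly ltnSn subnn expr0 mulr1 lead1.
apply/polyOverP => i; rewrite coef_poly; case: ltnP => [im|_]; last exact: rpred0.
move: im; rewrite ltnS leq_eqVlt => /orP[/eqP ->|im].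
  by rewrite subnn expr0 mulr1 lead1 rpred1.
rewrite Dp coef_map /= Dq coefZ coef_map /= -(subnSK im) exprS.
rewrite rmorphM /= fmorphV !rmorph_int -/A.
have A0 : A != 0 by rewrite intr_eq0.
have -> : A^-1 * (q`_i)%:~R * (A * A ^+ (m - i.+1)) = (q`_i)%:~R * A ^+ (m - i.+1).
  by field.
by rewrite rpredM ?rpredX ?rpred_int.
Qed.

Lemma rmorph_horner_in_alg (L : fieldExtType rat) (R : unitRingType)
    (s : {rmorphism L -> R}) (p : {poly rat}) (x : L) :
  s (map_poly (in_alg L) p).[x] = (map_poly ratr p).[s x].
Proof.
rewrite -horner_map -map_poly_comp; congr (_.[_]).
by apply: eq_map_poly => c /=; rewrite alg_num_field fmorph_rat.
Qed.

Lemma eq_rmorph_generator (L : fieldExtType rat) (R : unitRingType)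
    (s1 s2 : {rmorphism L -> R}) (g : L) :
  <<1%VS; g>>%VS = fullv -> s1 g = s2 g -> s1 =1 s2.
Proof.
move=> gen e x; have : x \in <<1; g>>%VS by rewrite gen memvf.
by case/Fadjoin1_polyP=> p ->; rewrite !rmorph_horner_in_alg e.
Qed.

Lemma generator_exists (L : fieldExtType rat) : exists g : L, <<1%VS; g>>%VS = fullv.
Proof.
have c0 : has_char0 L by move=> p; rewrite pchar_lalg pchar_num.
exists (separable_generator 1 {:L}).
have := @eq_adjoin_separable_generator _ L {:L}%AS 1%AS.
move=> /(_ _ (sub1v _)) <- //.
by apply/separableP => y _; apply: pcharf0_separable.
Qed.

Section RootEmbedding.
Variables (L : fieldExtType rat) (iota : {rmorphism L -> algC}) (g : L) (a : algC).
Hypothesis gen : <<1%VS; g>>%VS = fullv.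
Hypothesis ra : root (map_poly iota (minPoly 1 g)) a.

(** Substitution of [a] for [g] in the reduced expression of [y] as a polynomial in [g]. As [a] is a
    root of the minimal polynomial of [g], any other expression gives the same value, whence
    multiplicativity. *)
Definition root_emb (y : L) : algC := (map_poly iota (Fadjoin_poly 1 g y)).[a].

Fact root_emb_is_zmod_morphism : zmod_morphism root_emb.
Proof. by move=> x y; rewrite /root_emb linearB /= rmorphB /= hornerD hornerN. Qed.

Fact root_embE (p : {poly L}) : p \is a polyOver 1%VS ->
  root_emb p.[g] = (map_poly iota p).[a].
Proof.
move=> p1; rewrite /root_emb (Fadjoin_poly_mod _ p1).
rewrite [in RHS](divp_eq p (minPoly 1 g)) rmorphD rmorphM hornerD hornerM /=.
by rewrite (rootP ra) mulr0 add0r.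
Qed.

Fact root_emb_is_monoid_morphism : monoid_morphism root_emb.
Proof.
split.
  have E1 : 1%:P \is a polyOver (1%VS : {vspace L}) by rewrite polyOverC mem1v.
  by have := root_embE E1; rewrite hornerC map_polyC hornerC /= rmorph1.
have P (z : L) : exists2 p, p \is a polyOver 1%VS & z = p.[g].
  by apply: Fadjoin_polyP; rewrite gen memvf.
move=> x y; have [p p1 ->] := P x; have [q q1 ->] := P y.
have pq1 : p * q \is a polyOver (1%AS : {subfield L}) by rewrite rpredM.
by rewrite -hornerM !root_embE // rmorphM hornerM.
Qed.

HB.instance Definition _ :=
  GRing.isZmodMorphism.Build L algC root_emb root_emb_is_zmod_morphism.
HB.instance Definition _ :=
  GRing.isMonoidMorphism.Build L algC root_emb root_emb_is_monoid_morphism.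

Lemma embedding_of_root : exists s : {rmorphism L -> algC}, s g = a.
Proof.
exists (root_emb : {rmorphism L -> algC}) => /=.
have EX : 'X \is a polyOver (1%VS : {vspace L}).
  exact: (polyOverX (1%AS : {subfield L})).
by have := root_embE EX; rewrite hornerX map_polyX hornerX.
Qed.
End RootEmbedding.

Section RealEmbedding.
Variables (L : fieldExtType rat) (s : {rmorphism L -> algC}).
Hypothesis real_s : forall x, s x \is Num.real.

(** Taking values in the ordered field [algR] makes comparisons total and gives access to floors and
    truncations. *)
Definition real_emb (x : L) : algR := in_algR (real_s x).

Fact real_emb_is_zmod_morphism : zmod_morphism real_emb.
Proof. by move=> x y; apply: val_inj; rewrite /= rmorphB. Qed.

Fact real_emb_is_monoid_morphism : monoid_morphism real_emb.
Proof.
by split=> [|x y]; apply: val_inj; rewrite /= ?rmorph1 ?rmorphM.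
Qed.

HB.instance Definition _ :=
  GRing.isZmodMorphism.Build L algR real_emb real_emb_is_zmod_morphism.
HB.instance Definition _ :=
  GRing.isMonoidMorphism.Build L algR real_emb real_emb_is_monoid_morphism.
End RealEmbedding.

Lemma separable_map_minPoly (L : fieldExtType rat) (iota : {rmorphism L -> algC})
    (g : L) : separable_poly (map_poly iota (minPoly 1 g)).
Proof.
rewrite separable_map; apply: (pcharf0_separable 1%AS).
by move=> p; rewrite pchar_lalg pchar_num.
Qed.

(** The coefficients are rational, so [iota] and [s] carry this polynomial to the same one. *)
Lemma root_map_minPoly (L : fieldExtType rat) (iota s : {rmorphism L -> algC})
    (g : L) : root (map_poly iota (minPoly 1 g)) (s g).
Proof.
have /polyOver1P[p Dp] := minPolyOver 1%AS g.
have {}Dp : minPoly 1 g = map_poly (in_alg L) p by [].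
have R := minPolyxx 1%AS g; rewrite Dp in R *.
rewrite /root -map_poly_comp (@eq_map_poly _ _ _ ratr) => [|c /=].
  by rewrite -rmorph_horner_in_alg R rmorph0.
by rewrite alg_num_field fmorph_rat.
Qed.

(** If [t] generated a proper subfield [E], the restriction of [iota] to [E] would extend to [L] in
    a second way, and this other embedding would agree with [iota] at [t]. *)
Lemma generator_of_distinct_values (L : fieldExtType rat)
    (iota : {rmorphism L -> algC}) (t : L) :
    (forall s : {rmorphism L -> algC}, other_emb iota s -> s t != iota t) ->
  <<1%VS; t>>%VS = fullv.
Proof.
move=> distinct; have [g gen] := generator_exists L.
have gE : g \in <<1; t>>%AS.
  rewrite -adjoin_deg_eq1; apply/negPn/negP => deg1.
  set E := <<1; t>>%AS in deg1.
  set P := minPoly E g.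
  have sP : size P = (adjoin_degree E g).+1 by apply: size_minPoly.
  have rP : root (map_poly iota P) (iota g) by rewrite fmorph_root root_minPoly.
  have dvdP : map_poly iota P %| map_poly iota (minPoly 1 g).
    by rewrite dvdp_map; apply: (@minPolyS _ _ 1%AS E g); rewrite sub1v.
  have /factor_theorem[r Dr] := rP.
  have r0 : r != 0.
    apply: contra_eq_neq Dr => ->; rewrite mul0r map_poly_eq0.
    by rewrite monic_neq0 ?monic_minPoly.
  have sr : size r != 1.
    apply: contra deg1 => /eqP sr.
    by rewrite -eqSS -sP -(size_map_poly iota) Dr size_Mmonic ?monicXsubC // sr size_XsubC.
  have [a ra] := closed_rootP _ sr.
  have rPa : root (map_poly iota P) a by rewrite Dr rootM ra.
  (* Separability excludes a double root, so [a] is a genuinely different conjugate of [g] over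
     [E]. *)
  have ag : a != iota g.
    apply/eqP => ag; have := separable_map_minPoly iota g.
    move=> /(dvdp_separable dvdP); rewrite Dr separable_mul.
    case/and3P=> _ _ cop.
    by have := coprimep_root cop ra; rewrite ag hornerXsubC subrr eqxx.
  have rMa : root (map_poly iota (minPoly 1 g)) a by apply: root_dvdp rPa.
  have [s sg] := embedding_of_root gen rMa.
  suff st : s t = iota t.
    have /distinct : other_emb iota s by exists g; rewrite sg.
    by rewrite st eqxx.
  have /Fadjoin1_polyP[q Dq] : t \in <<1; g>>%VS by rewrite gen memvf.
  (* Writing [t = q(g)], the polynomial [q - t] has coefficients in [E] and vanishes at [g]. Hence
     its image vanishes at [a], and [s t = q(a) = iota t]. *)
  have dv : P %| map_poly (in_alg L) q - t%:P.
    apply: minPoly_dvdp; last by rewrite /root hornerD hornerN hornerC -Dq subrr.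
    by rewrite rpredB ?alg_polyOver // polyOverC memv_adjoin.
  have : root (map_poly iota (map_poly (in_alg L) q - t%:P)) a.
    by apply: root_dvdp rPa; rewrite dvdp_map.
  rewrite /root rmorphB /= map_polyC /= hornerD hornerN hornerC subr_eq0 => /eqP <-.
  rewrite [in LHS]Dq rmorph_horner_in_alg sg -map_poly_comp; congr (_.[_]).
  by apply: eq_map_poly => c /=; rewrite alg_num_field fmorph_rat.
apply/eqP; rewrite eqEsubv subvf -gen; apply/FadjoinP; split=> //.
exact: sub1v.
Qed.

(** All embeddings of a totally real field of degree [n + 1], with [iota] at index [ord0], and an
    integral generator that separates them. *)
Record real_frame (L : fieldExtType rat) (iota : {rmorphism L -> algC}) (n : nat) :=
  RealFrame {
    frame_gen : L;
    frame_emb : 'I_n.+1 -> {rmorphism L -> algR};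
    frame_dim : \dim {:L} = n.+1;
    frame_genP : <<1%VS; frame_gen>>%VS = fullv;
    frame_inj : injective (fun i => frame_emb i frame_gen);
    frame_int : iota frame_gen \in Aint;
    frame_iota : forall x, iota x = algRval (frame_emb ord0 x);
    frame_all : forall s : {rmorphism L -> algC},
      exists i, forall x, s x = algRval (frame_emb i x) }.

Lemma real_frame_exists (L : fieldExtType rat) (iota : {rmorphism L -> algC}) :
    (forall (s : {rmorphism L -> algC}) (x : L), s x \is Num.real) ->
  exists n, inhabited (real_frame iota n).
Proof.
move=> htr; have [g0 gen0] := generator_exists L.
have [D D0 intg] := Aint_multiple (iota g0).
pose g := D%:~R * g0.
have gen : <<1%VS; g>>%VS = fullv.
  apply/eqP; rewrite eqEsubv subvf -gen0; apply/FadjoinP; split; first exact: sub1v.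
  have -> : g0 = (D%:~R)^-1 * g.
    have DL0 : D%:~R != 0 :> L.
      by rewrite -(rmorph_int (in_alg L)) fmorph_eq0 intr_eq0.
    by rewrite mulKf.
  by rewrite rpredM ?memv_adjoin // rpredV rpred_int.
set p := map_poly iota (minPoly 1 g).
have [r Dr] := closed_field_poly_normal p.
have p1 : p \is monic by rewrite map_monic monic_minPoly.
have {}Dr : p = \prod_(z <- r) ('X - z%:P) by rewrite {1}Dr (monicP p1) scale1r.
have ur : uniq r by rewrite -separable_prod_XsubC -Dr separable_map_minPoly.
have memr z : (z \in r) = root p z by rewrite Dr root_prod_XsubC.
set n := (\dim {:L}).-1.
have dn : \dim {:L} = n.+1 by rewrite prednK // adim_gt0.
have sr : size r = n.+1.
  have := congr1 (fun q : {poly algC} => size q) Dr.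
  rewrite size_prod_XsubC size_map_poly size_minPoly.
  have := dim_Fadjoin 1%AS g; rewrite gen dimv1 muln1 dn => <-.
  by case.
have gr : iota g \in r by rewrite memr root_map_minPoly.
(* Moving [iota g] to the front of the list of conjugates makes [iota] the embedding of index 0. *)
pose r' := iota g :: rem (iota g) r.
have pr : perm_eq r r' := perm_to_rem gr.
have sr' : size r' = n.+1 by rewrite -(perm_size pr).
have ur' : uniq r' by rewrite -(perm_uniq pr).
have memr' z : (z \in r') = root p z by rewrite -(perm_mem pr) memr.
have /fin_all_exists[s Ds] (i : 'I_n.+1) :
    exists s : {rmorphism L -> algC}, s g = r'`_i.
  by apply: (@embedding_of_root _ iota _ _ gen); rewrite -/p -memr' mem_nth // sr'.
exists n; constructor.
apply: (@RealFrame L iota n g (fun i => real_emb (htr (s i)))) => //.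
- move=> i j /(congr1 algRval) /=; rewrite !Ds => /eqP.
  by rewrite nth_uniq ?sr' // => /eqP /val_inj.
- by rewrite rmorphM rmorph_int.
- move=> x /=.
  by apply: (eq_rmorph_generator gen); rewrite Ds.
move=> t; have tr : t g \in r' by rewrite memr' root_map_minPoly.
have lt : (index (t g) r' < n.+1)%N by rewrite -sr' index_mem.
exists (Ordinal lt) => x /=.
by apply: (eq_rmorph_generator gen); rewrite Ds /= nth_index.
Qed.

(** * Geometry of numbers *)

(** The minimal polynomial of [s x] has rational coefficients, so it also vanishes at [t x]. *)
Lemma Aint_embedding (L : fieldExtType rat) (s t : {rmorphism L -> algC}) (x : L) :
  s x \in Aint -> t x \in Aint.
Proof.
move=> sx; have [p [Dp p1] _] := minCpolyP (s x).
apply: (@root_monic_Aint (minCpoly (s x))); last exact: sx; last exact: minCpoly_monic.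
have := root_minCpoly (s x).
by rewrite Dp /root -!rmorph_horner_in_alg !fmorph_eq0.
Qed.

Section FrameGeometry.
Variables (L : fieldExtType rat) (iota : {rmorphism L -> algC}) (n : nat).
Variable F : real_frame iota n.
Local Notation e := (frame_emb F).
Local Notation g := (frame_gen F).

Lemma ZK_frame i x : ZK iota x -> algRval (e i x) \in Aint.
Proof. exact: (@Aint_embedding _ iota (algRval \o e i : {rmorphism L -> algC})). Qed.

(** Transposed Vandermonde matrix of the conjugates of [g]. It sends coordinates in the power basis
    of [g] to the vector of conjugates. *)
Definition frame_mx : 'M[algR]_n.+1 := \matrix_(i, j) e i (g ^+ j).

Lemma frame_mx_unit : frame_mx \in unitmx.
Proof.
have -> : frame_mx = (Vandermonde n.+1 (\row_i e i g))^T.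
  by apply/matrixP => i j; rewrite !mxE rmorphXn.
rewrite unitmx_tr unitmxE det_Vandermonde unitfE.
apply/prodf_neq0 => i _; apply/prodf_neq0 => j ij; rewrite !mxE subr_eq0.
by apply: contraTneq ij => /(@frame_inj _ _ _ F) ->; rewrite ltnn.
Qed.

Lemma frame_coord x : exists c : 'I_n.+1 -> rat, x = \sum_j c j *: g ^+ j.
Proof.
have /polyOver1P[p Dp] := Fadjoin_polyOver 1%AS g x.
exists (fun j => p`_j).
have xg : x \in <<1; g>>%VS by rewrite frame_genP memvf.
rewrite -{1}(Fadjoin_poly_eq xg) Dp.
have sp : (size (map_poly (in_alg L) p) <= n.+1)%N.
  rewrite -Dp (leq_trans (size_Fadjoin_poly _ _ _)) //.
  by have := dim_Fadjoin 1%AS g; rewrite frame_genP (frame_dim F) dimv1 muln1 => <-.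
rewrite (horner_coef_wide _ sp); apply: eq_bigr => j _.
by rewrite coef_map /= mulr_algl.
Qed.

Lemma frame_coordE x (c : 'I_n.+1 -> rat) : x = \sum_j c j *: g ^+ j ->
  forall j, ratr (c j) = \sum_i invmx frame_mx j i * e i x.
Proof.
move=> Dx j.
have H : frame_mx *m (\col_j ratr (c j)) = \col_i e i x.
  apply/colP => i; rewrite !mxE Dx rmorph_sum /=.
  by apply: eq_bigr => k _; rewrite !mxE rmorphZ_num mulrC.
have := congr1 (mulmx (invmx frame_mx)) H; rewrite mulKmx ?frame_mx_unit //.
move/colP/(_ j); rewrite !mxE => ->.
by apply: eq_bigr => i _; rewrite mxE.
Qed.

(** The inverse of [frame_mx] bounds the rational coordinates of [x]. If [D] makes the entries of
    that inverse integral, then [D] times a coordinate is a rational algebraic integer, so only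
    finitely many values remain. *)
Lemma ZK_bounded_finite (B : algR) : exists s : seq L,
  forall x, ZK iota x -> (forall i, `|e i x| <= B) -> x \in s.
Proof.
set V := invmx frame_mx.
have /fin_all_exists[E HE] (u : 'I_n.+1 * 'I_n.+1) :
    exists D : int, D != 0 /\ D%:~R * algRval (V u.1 u.2) \in Aint.
  by have [D D0 DA] := Aint_multiple (algRval (V u.1 u.2)); exists D.
pose D := \prod_u E u.
have D0 : D != 0 by apply/prodf_neq0 => u _; have [] := HE u.
have DV j i : D%:~R * algRval (V j i) \in Aint.
  rewrite /D (bigD1 (j, i)) //= mulrC intrM mulrA rpredM ?Aint_int //.
  by rewrite mulrC; have [] := HE (j, i).
pose S := \sum_j \sum_i `|V j i| * `|B|.
pose N := Num.bound (`|D%:~R : algR| * S).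
(* The numerators lie between [-N] and [N]; they are encoded by ordinals after a shift by [N]. *)
exists (codom (fun k : {ffun 'I_n.+1 -> 'I_(N + N).+1} =>
  \sum_j (((k j)%:Z - N%:Z)%:~R / D%:~R) *: g ^+ j)).
move=> x Zx xB; have [c Dx] := frame_coord x.
have cE := frame_coordE Dx.
have S0 j : 0 <= \sum_i `|V j i| * `|B|.
  by apply: sumr_ge0 => i _; rewrite mulr_ge0.
have cle j : `|ratr (c j) : algR| <= S.
  rewrite cE (le_trans (ler_norm_sum _ _ _)) //.
  rewrite (le_trans (_ : _ <= \sum_i `|V j i| * `|B|)) //.
    apply: ler_sum => i _; rewrite normrM ler_wpM2l //.
    by rewrite (le_trans (xB i)) // ler_norm.
  by rewrite /S [leRHS](bigD1 j) //= lerDl sumr_ge0.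
have Dc j : exists m : int, D%:~R * c j = m%:~R.
  apply/intrP; rewrite -Cint_rat Cint_rat_Aint ?Crat_rat //.
  have -> : ratr (D%:~R * c j) = D%:~R * algRval (ratr (c j)) :> algC.
    rewrite rmorphM rmorph_int; congr (_ * _); apply/esym.
    exact: (fmorph_rat (algRval : {rmorphism algR -> algC})).
  rewrite cE rmorph_sum mulr_sumr rpred_sum // => i _.
  by rewrite rmorphM mulrA rpredM ?DV // ZK_frame.
have [m Hm] : exists m : 'I_n.+1 -> int, forall j, D%:~R * c j = (m j)%:~R.
  exact: fin_all_exists Dc.
have mN j : (`|m j| < N)%N.
  rewrite -ltz_nat abszE -(ltr_int algR) intr_norm.
  have -> : (m j)%:~R = D%:~R * ratr (c j) :> algR.
    by rewrite -(rmorph_int (ratr : {rmorphism rat -> algR})) -Hm rmorphM rmorph_int.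
  rewrite normrM; apply: le_lt_trans (archi_boundP _).
    by rewrite ler_wpM2l.
  by rewrite mulr_ge0 // sumr_ge0.
apply/codomP; exists [ffun j => inord (absz (m j + N%:Z))].
rewrite {1}Dx; apply: eq_bigr => j _; congr (_ *: _).
rewrite ffunE inordK; last by have := mN j; lia.
have -> : (absz (m j + N%:Z))%:Z - N%:Z = m j by have := mN j; lia.
by rewrite -Hm mulrC mulKf // intr_eq0.
Qed.

(** * Integers with prescribed approximate conjugates *)

Definition frame_bound : algR := \sum_(i < n.+1) \sum_(j < n.+1) `|e i (g ^+ j)|.

Lemma frame_bound_ge0 : 0 <= frame_bound.
Proof. by apply: sumr_ge0 => i _; apply: sumr_ge0. Qed.

Lemma frame_comb_le (c : 'I_n.+1 -> algR) (b : algR) i :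
  (forall j, `|c j| <= b) -> `|\sum_j c j * e i (g ^+ j)| <= b * frame_bound.
Proof.
move=> cb; have b0 : 0 <= b by apply: le_trans (cb ord0).
rewrite (le_trans (ler_norm_sum _ _ _)) //.
rewrite (le_trans (_ : _ <= \sum_(j < n.+1) b * `|e i (g ^+ j)|)) //.
  by apply: ler_sum => j _; rewrite normrM ler_wpM2r.
rewrite -mulr_sumr ler_wpM2l // /frame_bound [leRHS](bigD1 i) //= lerDl.
by apply: sumr_ge0 => k _; apply: sumr_ge0.
Qed.

Lemma frame_comb_inj (c : 'I_n.+1 -> algR) :
  (forall i, \sum_j c j * e i (g ^+ j) = 0) -> forall j, c j = 0.
Proof.
move=> H j.
have H1 : frame_mx *m (\col_j c j) = 0.
  apply/colP => i; rewrite !mxE; apply: etrans (H i).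
  by apply: eq_bigr => k _; rewrite !mxE mulrC.
have := congr1 (mulmx (invmx frame_mx)) H1; rewrite mulKmx ?frame_mx_unit //.
by rewrite mulmx0 => /colP/(_ j); rewrite !mxE.
Qed.

Lemma frame_solve (T : 'I_n.+1 -> algR) :
  exists c : 'I_n.+1 -> algR, forall i, \sum_j c j * e i (g ^+ j) = T i.
Proof.
pose v := invmx frame_mx *m \col_i T i.
exists (fun j => v j 0) => i.
have : frame_mx *m v = \col_i T i by rewrite mulKVmx ?frame_mx_unit.
move/colP/(_ i); rewrite !mxE => <-.
by apply: eq_bigr => j _; rewrite !mxE mulrC.
Qed.

Lemma ZK_comb (c : 'I_n.+1 -> int) : ZK iota (\sum_j (c j)%:~R * g ^+ j).
Proof.
rewrite /ZK rmorph_sum rpred_sum // => j _.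
by rewrite rmorphM rmorphXn rmorph_int rpredM ?Aint_int ?rpredX ?frame_int.
Qed.

(* Dirichlet's pigeonhole argument on the lattice generated by the powers of g. *)
Lemma ZK_small (eps : algR) : 0 < eps ->
  exists2 a, a != 0 & ZK iota a /\ forall i, i != ord0 -> `|e i a| < eps.
Proof.
move=> eps0; set C := frame_bound.
have C0 : 0 <= C := frame_bound_ge0.
pose q := Num.bound (2 * C / eps).
have qC : 2 * C / eps < q%:R by apply: archi_boundP; rewrite divr_ge0 ?mulr_ge0 // ltW.
have q0 : (0 < q)%N.
  by rewrite -(ltr_nat algR) (le_lt_trans _ qC) // divr_ge0 ?mulr_ge0 // ltW.
(* With [N = q ^ n] there are [(N + 1) ^ (n + 1)] combinations, more than the [(N q + 1) ^ n] bins
   of width [eps], whose number is at most [(N + 1) ^ n q ^ n]. *)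
pose N := (q ^ n)%N.
pose comb (c : {ffun 'I_n.+1 -> 'I_N.+1}) : L := \sum_j (Posz (c j))%:~R * g ^+ j.
pose y c i := (e i (comb c) + N%:R * C) / eps.
have combE c i : e i (comb c) = \sum_j (c j)%:R * e i (g ^+ j).
  by rewrite rmorph_sum; apply: eq_bigr => j _; rewrite rmorphM rmorph_int.
have combN c i : `|e i (comb c)| <= N%:R * C.
  rewrite combE; apply: frame_comb_le => j.
  by rewrite ger0_norm // ler_nat -ltnS.
have y0 c i : 0 <= y c i.
  rewrite divr_ge0 ?(ltW eps0) //; have := combN c i; rewrite ler_norml.
  by move=> /andP[]; lra.
have yN c i : y c i <= (N * q)%:R.
  rewrite ler_pdivrMr // natrM.
  have /ltW qC' : 2 * C < q%:R * eps by rewrite -ltr_pdivrMr.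
  have := combN c i; rewrite ler_norml => /andP[_ h].
  have := ler_wpM2l (ler0n _ N) qC'; lra.
pose bin c : {ffun 'I_n -> 'I_(N * q).+1} :=
  [ffun i => inord (Num.truncn (y c (lift ord0 i)))].
have /injectivePn[c1 [c2 c12 bin12]] : ~~ injectiveb bin.
  apply/negP => /injectiveP /leq_card; rewrite !card_ffun !card_ord.
  apply/negP; rewrite -ltnNge.
  apply: (@leq_ltn_trans ((N.+1 * q) ^ n)).
    have lebin : ((N * q).+1 <= N.+1 * q)%N by nia.
    by elim: (n) => // k IH; rewrite !expnS leq_mul.
  by rewrite expnMn expnS mulnC ltn_mul2r expn_gt0 /= ltnSn.
exists (comb c1 - comb c2).
  apply: contra c12; rewrite subr_eq0 => /eqP e12; apply/eqP/ffunP => j.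
  apply: val_inj; apply/eqP; rewrite -(eqr_nat algR) -subr_eq0; apply/eqP.
  apply: (@frame_comb_inj (fun j => (c1 j)%:R - (c2 j)%:R)) => i.
  rewrite (eq_bigr (fun k => (c1 k)%:R * e i (g ^+ k) - (c2 k)%:R * e i (g ^+ k))).
    by rewrite sumrB -!combE e12 subrr.
  by move=> k _; rewrite mulrBl.
split.
  by rewrite /ZK rmorphB rpredB //; apply: ZK_comb.
move=> i; case: (unliftP ord0 i) => [k ->|->]; last by rewrite eqxx.
move=> _; set i' := lift _ _.
have : Num.truncn (y c1 i') = Num.truncn (y c2 i').
  have tr c : (Num.truncn (y c i') < (N * q).+1)%N.
    by rewrite ltnS -(ler_nat algR) (le_trans _ (yN c i')) // truncn_le.
  by have /ffunP/(_ k) := bin12; rewrite !ffunE => /(congr1 val); rewrite /= !inordK.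
move=> tr12.
have := truncn_itv (y0 c1 i'); have := truncn_itv (y0 c2 i'); rewrite tr12.
move=> /andP[h1 h2] /andP[h3 h4].
have : `|y c1 i' - y c2 i'| < 1.
  by rewrite ltr_norml; rewrite -natr1 in h2 h4; apply/andP; split; lra.
have -> : y c1 i' - y c2 i' = e i' (comb c1 - comb c2) / eps.
  by rewrite rmorphB /y -mulrBl; congr (_ / _); ring.
by rewrite normrM normfV (gtr0_norm eps0) ltr_pdivrMr // mul1r.
Qed.

(* Multiplying the lattice by an integer that is small at all embeddings but the first
   makes rounding harmless there. *)
Lemma ZK_approximation (T : 'I_n.+1 -> algR) (eps X : algR) : 0 < eps ->
  exists2 x, ZK iota x & X < e ord0 x /\ forall i, i != ord0 -> `|e i x - T i| < eps.
Proof.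
move=> eps0; set C := frame_bound; have C0 : 0 <= C := frame_bound_ge0.
have C1 : 0 < C + 1 by rewrite ltr_wpDl.
have [a a0 [Za sa]] := ZK_small (divr_gt0 eps0 C1).
have ea0 i : e i a != 0 by rewrite fmorph_eq0.
(* Rounding moves the value at embedding [i] by at most [|e i a| C]. The target at [ord0] is raised
   by this error plus 1, so that the result still exceeds [X]. *)
pose T' i := (if i == ord0 then X + `|e ord0 a| * C + 1 else T i).
have [c Hc] := frame_solve (fun i => T' i / e i a).
exists (a * \sum_j (Num.floor (c j))%:~R * g ^+ j).
  by rewrite /ZK rmorphM rpredM // ZK_comb.
have err i : `|e i (a * \sum_j (Num.floor (c j))%:~R * g ^+ j) - T' i| <= `|e i a| * C.
  have -> : e i (a * \sum_j (Num.floor (c j))%:~R * g ^+ j) - T' i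
      = e i a * \sum_j ((Num.floor (c j))%:~R - c j) * e i (g ^+ j).
    rewrite (eq_bigr (fun j => (Num.floor (c j))%:~R * e i (g ^+ j) - c j * e i (g ^+ j))).
      rewrite sumrB Hc mulrBr rmorphM rmorph_sum; congr (_ * _ - _).
        by apply: eq_bigr => j _; rewrite rmorphM rmorph_int.
      by rewrite mulrC mulfVK.
    by move=> j _; rewrite mulrBl.
  rewrite normrM ler_wpM2l // -[leRHS]mul1r; apply: frame_comb_le => j.
  have /andP[h1 h2] := floor_itv (c j); rewrite intrD in h2.
  by rewrite ler_norml; apply/andP; split; lra.
split.
  by have := err ord0; rewrite /T' eqxx ler_norml => /andP[h _]; lra.
move=> i i0; have := err i; rewrite /T' (negbTE i0) => /le_lt_trans; apply.
have := sa i i0; rewrite ltr_pdivlMr // => h.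
by have := normr_ge0 (e i a); nra.
Qed.

End FrameGeometry.

(** * Pisot numbers and their differences *)

Lemma root_minCpoly_embedding (L : fieldExtType rat)
    (s t : {rmorphism L -> algC}) (x : L) : root (minCpoly (s x)) (t x).
Proof.
have [p [Dp p1] _] := minCpolyP (s x); have := root_minCpoly (s x).
by rewrite Dp /root -!rmorph_horner_in_alg !fmorph_eq0.
Qed.

Section FrameSets.
Variables (L : fieldExtType rat) (iota : {rmorphism L -> algC}) (n : nat).
Variable F : real_frame iota n.
Local Notation e := (frame_emb F).
Local Notation g := (frame_gen F).

(* The values [e i x] are exactly the eigenvalues of the rational matrix of
   multiplication by [x]. *)
Lemma conjugate_frame x y : root (minCpoly (iota x)) y -> exists i, y = algRval (e i x).
Proof.
move=> ry.
have /fin_all_exists[M HM] (j : 'I_n.+1) := frame_coord F (x * g ^+ j).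
pose B : 'M[rat]_n.+1 := \matrix_(k, j) M j k.
pose W : 'M[algC]_n.+1 := map_mx algRval (frame_mx F).
pose D : 'M[algC]_n.+1 := diag_mx (\row_i algRval (e i x)).
have uW : W \in unitmx by rewrite map_unitmx frame_mx_unit.
(* The rows of [W] are left eigenvectors of the matrix of multiplication by [x], with eigenvalues
   [e i x]. As [W] is invertible, there are no further eigenvalues. *)
have WB : W *m map_mx ratr B = D *m W.
  apply/matrixP => i j; rewrite mul_diag_mx !mxE.
  rewrite -rmorphM -[in RHS]rmorphM HM rmorph_sum rmorph_sum.
  apply: eq_bigr => k _; rewrite !mxE rmorphZ_num rmorphM /= mulrC; congr (_ * _).
  exact/esym/(fmorph_rat (algRval : {rmorphism algR -> algC})).
have eigP a : eigenvalue (map_mx ratr B) a -> exists i, a = algRval (e i x).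
  case/eigenvalueP=> v Hv v0.
  pose u := v *m invmx W.
  have Du : u *m D = a *: u.
    have : u *m D *m W = a *: u *m W.
      by rewrite -mulmxA -WB mulmxA mulmxKV // Hv -scalemxAl mulmxKV.
    by move/(congr1 (mulmx^~ (invmx W))); rewrite !mulmxK.
  have u0 : u != 0.
    by apply: contraNneq v0 => u0; rewrite -(mulmxKV uW v) -/u u0 mul0mx.
  move: (u) Du u0 => {}u Du u0.
  have [i ui] : exists i, u 0 i != 0.
    apply/existsP; rewrite -negb_forall; apply: contra u0 => /forallP h.
    by apply/eqP/rowP => i; rewrite [RHS]mxE; apply/eqP/h.
  exists i; have /rowP/(_ i) := Du; rewrite mul_mx_diag !mxE mulrC.
  by move/(mulIf ui).
apply: eigP; rewrite eigenvalue_root_char -map_char_poly.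
(* The rational characteristic polynomial vanishes at [iota x], hence is divisible by its minimal
   polynomial, and so every conjugate is an eigenvalue. *)
have : root (map_poly ratr (char_poly B)) (iota x).
  rewrite map_char_poly -eigenvalue_root_char; apply/eigenvalueP.
  exists (row 0 W).
    rewrite -row_mul WB; apply/rowP => j; rewrite !mxE (bigD1 ord0) //= big1 => [|k k0].
      by rewrite !mxE eqxx mulr1n addr0 (frame_iota F).
    by rewrite !mxE eq_sym (negbTE k0) mul0r.
  apply/eqP => /rowP/(_ 0) /eqP; rewrite !mxE expr0 rmorph1 rmorph1 oner_eq0 //.
have [p [Dp _] pP] := minCpolyP (iota x); rewrite pP => dv.
by apply: root_dvdp ry; rewrite Dp dvdp_map.
Qed.

Lemma iota_lt x y : (iota x < iota y) = (e ord0 x < e ord0 y).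
Proof. by rewrite !(frame_iota F). Qed.

Lemma iota_le x y : (iota x <= iota y) = (e ord0 x <= e ord0 y).
Proof. by rewrite !(frame_iota F). Qed.

Lemma iota_gt0 x : (0 < iota x) = (0 < e ord0 x).
Proof. by rewrite -(rmorph0 iota) iota_lt rmorph0. Qed.

Lemma iota_lt2 x : (iota x < 2) = (e ord0 x < 2).
Proof. by rewrite -(rmorph_nat iota) iota_lt rmorph_nat. Qed.

Lemma iota_gt2 x : (2 < iota x) = (2 < e ord0 x).
Proof. by rewrite -(rmorph_nat iota) iota_lt rmorph_nat. Qed.

Lemma iota_gt1 x : (1 < iota x) = (1 < e ord0 x).
Proof. by rewrite -(rmorph1 iota) iota_lt rmorph1. Qed.

Lemma iota_real x : iota x \is Num.real.
Proof. by rewrite (frame_iota F) algRvalP. Qed.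

Lemma frame_other (Q : algC -> Prop) x :
  (forall s : {rmorphism L -> algC}, other_emb iota s -> Q (s x)) <->
  (forall i, i != ord0 -> Q (algRval (e i x))).
Proof.
split=> H => [i i0|s [y sy]].
  apply: (H (algRval \o e i : {rmorphism L -> algC})); exists g.
  rewrite (frame_iota F) /=; apply: contra i0 => /eqP /val_inj /(@frame_inj _ _ _ F).
  by move->.
have [i Hi] := frame_all F s; rewrite Hi; apply: H.
by apply: contraNneq sy => i0; rewrite Hi i0 (frame_iota F).
Qed.

Lemma frame_generator x :
  <<1%VS; x>>%VS = fullv <-> (forall i, i != ord0 -> e i x != e ord0 x).
Proof.
split=> [gen i i0|H].
  apply: contra i0 => /eqP ei; apply/eqP/(@frame_inj _ _ _ F).
  exact: eq_rmorph_generator gen ei g.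
apply: (@generator_of_distinct_values _ iota).
have := (frame_other (fun z => z != iota x) x).2; apply => i i0.
by rewrite (frame_iota F); apply: contra (H i i0) => /eqP/val_inj ->.
Qed.

Definition pisotb x :=
  [&& iota x \in Aint, 1 < e ord0 x & [forall (i | i != ord0), `|e i x| < 1]].

(** A value above 1 differs from values in (-1, 1), so such an [x] generates the field. Conversely,
    each other embedding sends a generator to a conjugate different from [iota x]. *)
Lemma PisotK_frame x : PisotK iota x <-> pisotb x.
Proof.
split=> [[[_ Ax x1 H] gen]|/and3P[Ax x1 /forall_inP H]].
  apply/and3P; split=> //; first by rewrite -iota_gt1.
  apply/forall_inP => i i0.
  have := H (algRval (e i x)); apply.
    exact: (root_minCpoly_embedding iota (algRval \o e i : {rmorphism L -> algC})).
  rewrite (frame_iota F); apply: contra ((frame_generator x).1 gen i i0).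
  by move/eqP/val_inj ->.
split; last first.
  apply/frame_generator => i i0; have := H i i0; rewrite ltr_norml => /andP[_ h].
  by rewrite lt_eqF // (lt_trans h).
split=> //; first exact: iota_real; first by rewrite iota_gt1.
move=> y /conjugate_frame[i ->]; have [->|i0] := eqVneq i ord0.
  by rewrite (frame_iota F) eqxx.
by move=> _; apply: (H i i0).
Qed.

Definition ekb x :=
  [&& iota x \in Aint, 0 < e ord0 x & [forall (i | i != ord0), 0 < `|e i x| < 2]].

Lemma EK_frame x : EK iota x <-> ekb x.
Proof.
have := frame_other (fun z => 0 < `|z| < 2) x => H; split.
  case=> Zx x0 /H h; apply/and3P; split; rewrite -?iota_gt0 //.
  by apply/forall_inP => i /h.
case/and3P=> Zx x0 /forall_inP h; split=> //; first by rewrite iota_gt0.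
by apply/H => i /h.
Qed.

Lemma DK_EK x : DK iota x <-> EK iota x.
Proof.
split.
  case=> a [b] [/PisotK_frame/and3P[Aa a1 /forall_inP Ha]].
  move=> /PisotK_frame/and3P[Ab b1 /forall_inP Hb]; rewrite iota_lt => ab Dx.
  apply/EK_frame/and3P; split; first by rewrite Dx rmorphB rpredB.
    by rewrite Dx rmorphB subr_gt0.
  have x0 : x != 0 by rewrite Dx subr_eq0; apply: contraTneq ab => ->; rewrite ltxx.
  apply/forall_inP => i i0; rewrite normr_gt0 fmorph_eq0 x0 /=.
  have := Ha i i0; have := Hb i i0; rewrite Dx rmorphB !ltr_norml.
  by move=> /andP[? ?] /andP[? ?]; apply/andP; split; lra.
move/EK_frame/and3P => [Ax x0 /forall_inP Hx].
(* If the conjugates of [b] are close to [- e i x / 2], those of [b + x] are close to [e i x / 2].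
   Both stay in (-1, 1) for an error below [1 - |e i x| / 2]. *)
pose T i : algR := - e i x / 2.
have [eps eps0 Heps] : exists2 eps : algR, 0 < eps &
    forall i, i != ord0 -> eps <= 1 - `|e i x| / 2.
  pose S := \big[Order.min/1]_(i | i != ord0) (1 - `|e i x| / 2).
  exists S; last by move=> i i0; apply: bigmin_le_cond.
  apply/bigmin_gtP; split=> // i i0; have := Hx i i0 => /andP[_]; lra.
have [b Zb [b1 Hb]] := ZK_approximation F T 1 eps0.
have pb : pisotb b.
  apply/and3P; split=> //; apply/forall_inP => i i0.
  have := Hb i i0; have := Heps i i0; rewrite /T !ltr_norml => h1 /andP[h2 h3].
  have := ler_norm (e i x); have := ler_norm (- e i x); rewrite normrN => h4 h5.
  by apply/andP; split; lra.
have pa : pisotb (b + x).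
  apply/and3P; split; first by rewrite rmorphD rpredD.
    by rewrite rmorphD; lra.
  apply/forall_inP => i i0.
  have := Hb i i0; have := Heps i i0; rewrite /T rmorphD !ltr_norml => h1 /andP[h2 h3].
  have := ler_norm (e i x); have := ler_norm (- e i x); rewrite normrN => h4 h5.
  by apply/andP; split; lra.
exists (b + x), b; split; rewrite ?PisotK_frame //.
  by rewrite iota_lt rmorphD ltrDl.
by rewrite addrC addKr.
Qed.

End FrameSets.

(** * Root of unity traces *)

Lemma trace_surj (r : algC) : exists2 w, w != 0 & r = w + w^-1.
Proof.
pose w := (r + sqrtC (r ^+ 2 - 4)) / 2.
have q : w ^+ 2 - r * w + 1 = 0.
  have h : sqrtC (r ^+ 2 - 4) ^+ 2 = r ^+ 2 - 4 by rewrite sqrtCK.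
  by rewrite /w; move: (sqrtC _) h => y h; field: h.
have w0 : w != 0.
  by apply: contra_eq_neq q => ->; rewrite expr0n mulr0 subr0 add0r oner_eq0.
exists w => //; apply: (mulIf w0); rewrite mulrDl mulVf // -expr2.
by apply/eqP; rewrite eq_sym -subr_eq0 -q; apply/eqP; ring.
Qed.

Lemma trace_eq (z w : algC) : z != 0 -> w != 0 ->
  z + z^-1 = w + w^-1 -> z = w \/ z = w^-1.
Proof.
move=> z0 w0 h.
have : (z - w) * (z * w - 1) = 0.
  have -> : (z - w) * (z * w - 1) = z * w * (z + z^-1 - (w + w^-1)).
    by field; rewrite z0 w0.
  by rewrite h subrr mulr0.
move/eqP; rewrite mulf_eq0 !subr_eq0 => /orP[/eqP ->|/eqP zw]; first by left.
by right; rewrite -[LHS](mulfK w0) zw mul1r.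
Qed.

Lemma trace_eq2 (w : algC) : w != 0 -> w + w^-1 = 2 -> w = 1.
Proof.
move=> w0 h; have : w + w^-1 = 1 + 1^-1 by rewrite h invr1.
by case/trace_eq=> //; rewrite ?oner_eq0 // invr1.
Qed.

Lemma trace_eqN2 (w : algC) : w != 0 -> w + w^-1 = - 2 -> w = -1.
Proof.
move=> w0 h; have : w + w^-1 = -1 + (-1)^-1 by rewrite h invrN1 -opprD.
by case/trace_eq=> //; rewrite ?oppr_eq0 ?oner_eq0 // invrN1.
Qed.

Lemma real_trace_ge2 (R : realFieldType) (u : R) : u != 0 -> 2 <= `|u + u^-1|.
Proof.
move=> u0; rewrite leNgt ltr_norml; apply/negP => /andP[h1 h2].
have h3 : u * u^-1 = 1 by rewrite mulfV.
move: (u^-1 : R) h1 h2 h3 => v h1 h2 h3.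
have h4 : 0 < (2 - (u + v)) * (2 + (u + v)) by rewrite mulr_gt0 //; lra.
by have := sqr_ge0 (u - v); nra.
Qed.

(** A real trace is also the trace of the complex conjugate of [w], which is therefore [w] or
    [w^-1]. The second case means modulus 1; in the first, [w] is real and its trace has absolute
    value at least 2. *)
Lemma real_trace_norm1 (w : algC) : w != 0 ->
  w + w^-1 \is Num.real -> `|w + w^-1| < 2 -> `|w| = 1.
Proof.
move=> w0 rw wlt.
have wc0 : w^* != 0 by rewrite conjC_eq0.
have : w + w^-1 = w^* + (w^*)^-1 by rewrite -fmorphV -rmorphD /= (CrealP rw).
case/trace_eq=> // [wc|wc]; last first.
  by apply/eqP; rewrite -sqrp_eq1 // normCK {1}wc mulVf.
have w_real : w \is Num.real by apply/CrealP.
pose u : algR := in_algR w_real.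
have u0 : u != 0 by apply: contraNneq w0 => /(congr1 algRval) /= ->.
have : `|u + u^-1| < 2 by [].
by rewrite ltNge real_trace_ge2.
Qed.

Lemma norm1_trace_lt2 (w : algC) : `|w| = 1 -> w + w^-1 \is Num.real ->
  w + w^-1 != 2 -> w + w^-1 != - 2 -> `|w + w^-1| < 2.
Proof.
move=> w1 rw n2 nN2; rewrite lt_neqAle; apply/andP; split; last first.
  by rewrite (le_trans (ler_normD _ _)) // normfV w1 invr1.
apply/eqP => h.
have : `|w + w^-1| ^+ 2 == 2 ^+ 2 by rewrite h.
by rewrite real_normK // eqf_sqr (negbTE n2) (negbTE nN2).
Qed.

(* Reduction of [m] modulo ['X^2 - b 'X + 1], whose roots are [w] and [w^-1]
   when [b] is embedded as [w + w^-1]. *)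
Lemma trace_remainder (L : fieldExtType rat) (b : L) (m : {poly rat}) :
  exists c0 c1 : L, forall (s : {rmorphism L -> algC}) (w : algC),
    w != 0 -> s b = w + w^-1 -> (map_poly ratr m).[w] = s c0 + s c1 * w.
Proof.
pose Q : {poly L} := 'X^2 - b *: 'X + 1.
have sQ : size Q = 3%N.
  rewrite /Q -addrA size_polyDl size_polyXn //.
  rewrite (leq_ltn_trans (size_polyD _ _)) // gtn_max size_poly1 size_polyN.
  by rewrite (leq_ltn_trans (size_scale_leq _ _)) // size_polyX.
pose M := map_poly (in_alg L) m; pose R := M %% Q.
exists R`_0, R`_1 => s w w0 sb.
have sR : (size R <= 2)%N by rewrite -ltnS -sQ ltn_modp -size_poly_gt0 sQ.
have DM : map_poly s M = map_poly ratr m.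
  rewrite -map_poly_comp; apply: eq_map_poly => c /=.
  by rewrite alg_num_field fmorph_rat.
rewrite -DM (divp_eq M Q) rmorphD rmorphM hornerD hornerM /= -/R.
have -> : (map_poly s Q).[w] = 0.
  rewrite rmorphD rmorphB /= map_polyXn map_polyZ map_polyX rmorph1.
  by rewrite !hornerE sb; field.
rewrite mulr0 add0r (@horner_coef_wide _ 2) ?size_map_poly //.
by rewrite big_ord_recl big_ord1 !coef_map /= expr0 expr1 mulr1.
Qed.

Lemma nat_fun_collision (T : eqType) (f : nat -> T) (s : seq T) :
  (forall k, f k \in s) -> exists i j, (i < j)%N /\ f i = f j.
Proof.
move=> fs; have : ~~ uniq (mkseq f (size s).+1).
  apply/negP => /uniq_leq_size /(_ _) le.
  have /le : {subset mkseq f (size s).+1 <= s} by move=> x /mapP[k _ ->].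
  by rewrite size_mkseq ltnn.
case/(uniqPn (f 0))=> i [j []]; rewrite size_mkseq => ij js.
by rewrite !nth_mkseq ?(ltn_trans ij js) // => h; exists i, j.
Qed.

(** Dickson polynomials with parameter 1: they express [w^k + w^-k] through [b = w + w^-1]. *)
Fixpoint power_trace (R : pzRingType) (b : R) (k : nat) : R :=
  if k is k1.+1 then
    if k1 is k2.+1 then b * power_trace b k1 - power_trace b k2 else b
  else 2.

Lemma power_traceE (R : nzRingType) (s : {rmorphism R -> algC}) (b : R) (w : algC) k :
  w != 0 -> s b = w + w^-1 -> s (power_trace b k) = w ^+ k + w ^- k.
Proof.
move=> w0 sb; elim/ltn_ind: k => -[|[|k]] IH /=.
- by rewrite expr0 invr1 rmorph_nat.
- by rewrite sb expr1.
rewrite rmorphB rmorphM -/(power_trace b k.+1) IH // IH // sb !exprS.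
by field; rewrite w0 expf_neq0.
Qed.

Section FrameTraces.
Variables (L : fieldExtType rat) (iota : {rmorphism L -> algC}) (n : nat).
Variable F : real_frame iota n.
Local Notation e := (frame_emb F).

Let ec i : {rmorphism L -> algC} := algRval \o e i.

Lemma ZK_power_trace b k : ZK iota b -> ZK iota (power_trace b k).
Proof.
rewrite /ZK => Zb; elim/ltn_ind: k => -[|[|k]] IH //=.
  by rewrite rmorph_nat Aint_Cnat ?rpred_nat.
by rewrite -/(power_trace b k.+1) rmorphB rmorphM rpredB ?rpredM // IH.
Qed.

(** The powers of [x] are bounded integers, so two of them coincide; a nonzero [x] would then have
    absolute value 1. *)
Lemma ZK_small_eq0 x : ZK iota x -> (forall i, `|e i x| < 1) -> x = 0.
Proof.
move=> Zx x1; apply/eqP/negPn/negP => x0.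
have [s Hs] := ZK_bounded_finite F 1.
have [|i [j [ij xij]]] := @nat_fun_collision _ (fun k => x ^+ k) s.
  move=> k; apply: Hs; first by rewrite /ZK rmorphXn rpredX.
  by move=> i; rewrite rmorphXn normrX exprn_ile1 // ltW.
have : x ^+ (j - i) = 1.
  by apply: (mulIf (expf_neq0 i x0)); rewrite -exprD subnK ?mul1r // ltnW.
move/(congr1 (e ord0)); rewrite rmorphXn rmorph1 => /(congr1 Num.norm).
move/eqP; rewrite normrX normr1 pexprn_eq1 // subn_eq0 leqNgt ij /= => /eqP h.
by have := x1 ord0; rewrite h ltxx.
Qed.

Lemma emb_trace_norm1 i x w : w != 0 -> algRval (e i x) = w + w^-1 ->
  `|e i x| < 2 -> `|w| = 1.
Proof.
move=> w0 h lt2; apply: real_trace_norm1 => //; rewrite -h; first exact: algRvalP.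
exact: lt2.
Qed.

Lemma emb_norm1_trace i x w : algRval (e i x) = w + w^-1 -> `|w| = 1 ->
  x != 2 -> x != - 2 -> `|e i x| < 2.
Proof.
move=> h w1 x2 xN2.
suff : `|algRval (e i x)| < 2 by [].
rewrite h; apply: norm1_trace_lt2; rewrite -?h ?algRvalP //.
  apply: contra x2 => /eqP E; apply/eqP/(fmorph_inj (ec i)).
  by rewrite rmorph_nat -E.
apply: contra xN2 => /eqP E; apply/eqP/(fmorph_inj (ec i)).
by rewrite rmorphN rmorph_nat -E.
Qed.

(** The remainder of [X^m - 1] modulo [X^2 - x X + 1] vanishes at [z] and at [z^-1], which are
    distinct, so it is zero. Under every embedding, [x] is then the trace of an [m]-th root of
    unity. The values 2 and -2 would mean [z = 1] or [z = -1], against [m >= 4]. *)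
Lemma UK_bounds x : UK iota x -> [/\ ZK iota x, 0 < e ord0 x & forall i, 0 < `|e i x| < 2].
Proof.
case=> Ax x0 [m [m4 [z [pz Dx]]]].
have x0' : x != 0 by apply: contraTneq x0 => ->; rewrite rmorph0 ltxx.
split=> //; first by rewrite -iota_gt0.
have zm : z ^+ m = 1 := prim_expr_order pz.
have z0 : z != 0.
  apply: contra_eq_neq zm => ->.
  by rewrite expr0n eqn0Ngt (leq_trans _ m4) // eq_sym oner_eq0.
have zV : z - z^-1 != 0.
  rewrite subr_eq0; apply/eqP => h.
  have : z ^+ 2 == 1 by rewrite expr2 {1}h mulVf.
  by rewrite -(prim_order_dvd pz) => /dvdn_leq => /(_ isT); rewrite leqNgt (leq_trans _ m4).
have [c0 [c1 Hc]] := trace_remainder x ('X^m - 1).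
have hm w : (map_poly ratr ('X^m - 1)).[w] = w ^+ m - 1 :> algC.
  by rewrite rmorphB /= map_polyXn rmorph1 !hornerE.
have := Hc iota z z0 Dx; rewrite hm zm subrr => E1.
have := Hc iota z^-1; rewrite invr_eq0 invrK addrC => /(_ z0 Dx).
rewrite hm exprVn zm invr1 subrr => E2.
have c10 : c1 = 0.
  apply/eqP; rewrite -(fmorph_eq0 iota); apply/eqP/(mulIf zV); rewrite mul0r.
  have -> : iota c1 * (z - z^-1) =
      (iota c0 + iota c1 * z) - (iota c0 + iota c1 * z^-1) by ring.
  by rewrite -E1 -E2 subrr.
move: E1; rewrite c10 rmorph0 mul0r addr0 => /esym/eqP; rewrite fmorph_eq0 => /eqP c00.
move=> i; rewrite normr_gt0 fmorph_eq0 x0' /=.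
have [w w0 Hw] := trace_surj (algRval (e i x)).
have := Hc (ec i) w w0 Hw; rewrite hm c10 c00 !rmorph0 mul0r addr0 => /eqP.
rewrite subr_eq0 => /eqP wm.
apply: (emb_norm1_trace Hw).
- have : `|w| ^+ m == 1 by rewrite -normrX wm normr1.
  by rewrite pexprn_eq1 // => /orP[/eqP m0|/eqP //]; rewrite m0 in m4.
- apply/eqP => x2; have := Dx; rewrite x2 rmorph_nat => /esym/(trace_eq2 z0) z1.
  have : z ^+ 1 == 1 by rewrite z1.
  by rewrite -(prim_order_dvd pz) dvdn1 => /eqP m1; rewrite m1 in m4.
apply/eqP => x2; have := Dx; rewrite x2 rmorphN rmorph_nat => /esym/(trace_eqN2 z0) z1.
have : z ^+ 2 == 1 by rewrite z1 sqrrN expr1n.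
by rewrite -(prim_order_dvd pz) => /dvdn_leq => /(_ isT); rewrite leqNgt (leq_trans _ m4).
Qed.

(* Kronecker's theorem for [w + w^-1]: the traces [w^k + w^-k] are integers of [L]
   bounded by [2] in every embedding, hence take finitely many values. *)
Lemma UK_of_bounds x : ZK iota x -> 0 < e ord0 x -> (forall i, `|e i x| < 2) -> UK iota x.
Proof.
move=> Zx x0 xlt; split=> //; first by rewrite (iota_gt0 F).
have [s Hs] := ZK_bounded_finite F 2.
have [|i [j [ij xij]]] := @nat_fun_collision _ (power_trace x) s.
  move=> k; apply: Hs; first exact: ZK_power_trace.
  move=> i; have [w w0 Hw] := trace_surj (algRval (e i x)).
  have w1 := emb_trace_norm1 w0 Hw (xlt i).
  suff : `|ec i (power_trace x k)| <= 2 by [].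
  rewrite (@power_traceE _ (ec i) x w k w0 Hw) (le_trans (ler_normD _ _)) //.
  by rewrite normfV normrX w1 expr1n invr1.
have [z z0 Hz] := trace_surj (iota x).
have := congr1 iota xij; rewrite !(power_traceE _ z0 Hz) => h.
have [N N0 zN] : exists2 N, (0 < N)%N & z ^+ N = 1.
  case: (trace_eq _ _ h) => [||E|E]; rewrite ?expf_neq0 //.
    exists (j - i)%N; first by rewrite subn_gt0.
    by apply: (mulIf (expf_neq0 i z0)); rewrite -exprD subnK ?mul1r // ltnW.
  exists (i + j)%N; first by rewrite addn_gt0 (leq_ltn_trans _ ij) ?orbT.
  by rewrite exprD E mulVf // expf_neq0.
have [m pz _] := prim_order_exists N0 zN.
exists m; split; last by exists z.
have xr : 0 < iota x < 2.
  rewrite (iota_gt0 F) (iota_lt2 F) x0 /=.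
  by have := xlt ord0; rewrite ltr_norml => /andP[].
have := prim_order_gt0 pz; have zm := prim_expr_order pz.
(* Orders 1, 2 and 3 give the traces 2, -2 and -1, all outside (0, 2). *)
case: m pz zm => [|[|[|[|m]]]] // pz zm _.
- by move: xr; rewrite Hz -[z]expr1 zm invr1 ltxx andbF.
- have : (z - 1) * (z + 1) == 0 by rewrite -subr_sqr_1 zm subrr.
  rewrite mulf_eq0 subr_eq0 addr_eq0 => /orP[]/eqP z1; move: xr; rewrite Hz z1.
    by rewrite invr1 ltxx andbF.
  by rewrite invrN1 -opprD oppr_gt0 -[1 + 1]/(2%:R) ltrn0.
have : (z - 1) * (z ^+ 2 + z + 1) == 0.
  have -> : (z - 1) * (z ^+ 2 + z + 1) = z ^+ 3 - 1 by ring.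
  by rewrite zm subrr.
rewrite mulf_eq0 subr_eq0 => /orP[/eqP z1|/eqP z1]; move: xr; rewrite Hz.
  by rewrite z1 invr1 ltxx andbF.
have -> : z + z^-1 = -1.
  apply: (mulIf z0); apply/eqP; rewrite -subr_eq0; apply/eqP; rewrite -z1.
  by field.
by rewrite oppr_gt0 ltr10.
Qed.

Lemma UK_frame x : UK iota x <-> ekb F x && (e ord0 x < 2).
Proof.
split=> [/UK_bounds[Zx x0 H]|/andP[/and3P[Zx x0 /forall_inP H] x2]].
  apply/andP; split; last by have /andP[_] := H ord0; rewrite ltr_norml => /andP[].
  by apply/and3P; split=> //; apply/forall_inP => i _.
apply: UK_of_bounds => // i; have [->|i0] := eqVneq i ord0; first by rewrite gtr0_norm.
by have /andP[] := H i i0.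
Qed.

End FrameTraces.

(** * Salem traces *)

Lemma minCpoly_dvdp (x : algC) (q : {poly rat}) :
  root (map_poly ratr q) x -> minCpoly x %| map_poly ratr q.
Proof. by have [p [-> _] ->] := minCpolyP x; rewrite dvdp_map. Qed.

(** If [p = r q] with [q] the minimal polynomial of [y], then [t] is a root of [r] or of [q]. The
    degree prevents [p] from dividing [r], so it divides [q]. *)
Lemma minCpoly_conjugate (t y : algC) :
  root (minCpoly t) y -> minCpoly y = minCpoly t.
Proof.
have [p [Dp p1] pP] := minCpolyP t; have [q [Dq q1] qP] := minCpolyP y.
rewrite Dp qP => /dvdpP[r Dr].
suff pq : p %| q.
  have /eqP : p == q.
    by rewrite -eqp_monic // /eqp pq Dr dvdp_mull.
  by rewrite Dq => ->.
have : root (map_poly ratr p) t by rewrite -Dp root_minCpoly.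
rewrite {1}Dr rmorphM rootM !pP => /orP[|//] pr.
have r0 : r != 0.
  apply: contraTneq p1 => r0.
  by rewrite Dr r0 mul0r monicE lead_coef0 eq_sym oner_eq0.
exfalso; have := dvdp_leq r0 pr; rewrite Dr size_Mmonic //.
have : (1 < size q)%N.
  by rewrite -(size_map_poly (ratr : {rmorphism rat -> algC})) -Dq size_minCpoly.
have : (0 < size r)%N by rewrite size_poly_gt0.
by move: (size q) (size r) => a b; lia.
Qed.

Lemma conjugate_neq0 (t y : algC) : t != 0 -> root (minCpoly t) y -> y != 0.
Proof.
move=> t0; apply: contraTneq => -> {y}; apply: contra t0 => r0.
have : root (map_poly ratr 'X) (0 : algC) by rewrite map_polyX rootX.
move/minCpoly_dvdp; rewrite (minCpoly_conjugate r0).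
by move/root_dvdp/(_ (root_minCpoly t)); rewrite map_polyX rootX.
Qed.

(** The polynomial [B^d p(A / B)]. With [A = 1], [B = X] it is the reciprocal polynomial; with
    [A = X^2 + 1], [B = X] it is [X^d p(X + 1/X)]. *)
Definition homog_poly (R : nzRingType) (d : nat) (p : seq R) (A B : {poly R}) : {poly R} :=
  \sum_(k < d.+1) p`_k *: (A ^+ k * B ^+ (d - k)).

Lemma homog_poly_horner (R K : fieldType) (f : {rmorphism R -> K}) d
    (p A B : {poly R}) (y : K) :
    (size p <= d.+1)%N -> (map_poly f B).[y] != 0 ->
  (map_poly f (homog_poly d p A B)).[y] =
    (map_poly f B).[y] ^+ d * (map_poly f p).[(map_poly f A).[y] / (map_poly f B).[y]].
Proof.
move=> sp B0; rewrite rmorph_sum horner_sum.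
rewrite [(map_poly f p).[_]](@horner_coef_wide _ d.+1) ?size_map_poly // mulr_sumr.
apply: eq_bigr => k _; rewrite /= map_polyZ hornerZ rmorphM !rmorphXn hornerM !horner_exp.
rewrite coef_map /=; have kd : (k <= d)%N by rewrite -ltnS.
have -> : (map_poly f B).[y] ^+ d = (map_poly f B).[y] ^+ (d - k) * (map_poly f B).[y] ^+ k.
  by rewrite -exprD subnK.
by rewrite exprMn exprVn; field; rewrite expf_neq0.
Qed.

(** On the unit circle [y^-1] is the complex conjugate of [y], hence a root too. The reciprocal
    polynomial thus vanishes at [y], and so at its conjugate [t]. *)
Lemma reciprocal_conjugate (t y : algC) : t != 0 ->
  root (minCpoly t) y -> `|y| = 1 -> root (minCpoly t) t^-1.
Proof.
move=> t0 ry y1.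
have y0 : y != 0 by rewrite -normr_gt0 y1 ltr01.
have [p [Dp p1] _] := minCpolyP t.
have yV : y^-1 = y^*.
  by apply: (mulfI y0); rewrite mulfV // -normCK y1 expr1n.
have ryV : root (map_poly ratr p) y^-1.
  move: ry; rewrite Dp yV -(fmorph_root Num.conj) -map_poly_comp.
  congr (root _ _); apply: eq_map_poly => c /=.
  exact: (fmorph_rat (Num.conj : {rmorphism algC -> algC})).
pose d := (size p).-1; have sp : (size p <= d.+1)%N by rewrite /d; case: (size p).
pose r := homog_poly d p 1 'X.
have rE (u : algC) : u != 0 ->
    (map_poly ratr r).[u] = u ^+ d * (map_poly ratr p).[u^-1].
  move=> u0; rewrite homog_poly_horner // map_polyX hornerX //.
  by rewrite rmorph1 hornerC mul1r.
have : root (map_poly ratr r) y by rewrite /root rE // (rootP ryV) mulr0.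
move/minCpoly_dvdp; rewrite (minCpoly_conjugate ry) => /root_dvdp/(_ (root_minCpoly t)).
by rewrite /root rE // mulf_eq0 expf_eq0 (negbTE t0) andbF Dp.
Qed.

(** The term of index [k] has degree at most [d + k], so only the last one reaches degree [2 d]. *)
Lemma trace_poly_monic (R : fieldType) d (p : {poly R}) :
  p \is monic -> size p = d.+1 -> homog_poly d p ('X^2 + 1) 'X \is monic.
Proof.
move=> p1 sp; rewrite /homog_poly big_ord_recr /= subnn expr0 mulr1.
have A1 : ('X^2 + 1 : {poly R}) \is monic.
  by rewrite monicE lead_coefDl ?lead_coefXn // size_polyXn size_poly1.
have sA k : size (('X^2 + 1 : {poly R}) ^+ k) = (2 * k).+1.
  have := size_exp ('X^2 + 1 : {poly R}) k.
  rewrite size_polyDl ?size_polyXn ?size_poly1 //= => <-.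
  by rewrite prednK // size_poly_gt0 expf_neq0 // monic_neq0.
have -> : p`_d = 1 by have := monicP p1; rewrite lead_coefE sp.
rewrite scale1r monicE lead_coefDr; first by rewrite -monicE monic_exp.
rewrite sA ltnS (leq_trans (size_sum _ _ _)) //; apply/bigmax_leqP => k _.
rewrite (leq_trans (size_scale_leq _ _)) // size_mulXn ?expf_neq0 ?monic_neq0 //.
by rewrite sA; have := ltn_ord k; lia.
Qed.

Section FrameSalem.
Variables (L : fieldExtType rat) (iota : {rmorphism L -> algC}) (n : nat).
Variable F : real_frame iota n.
Local Notation e := (frame_emb F).
Let ec i : {rmorphism L -> algC} := algRval \o e i.

Lemma degK_generator (x : L) : degK x = n.+1 <-> <<1%VS; x>>%VS = fullv.
Proof.
have dx := dim_Fadjoin 1%AS x; rewrite dimv1 muln1 in dx.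
split=> [h|h].
  apply/eqP; rewrite eqEdim subvf (frame_dim F) dx -h; exact: leqnn.
by rewrite /degK -dx h (frame_dim F).
Qed.

Lemma TK_frame x : TK iota x <-> ekb F x && (2 < e ord0 x).
Proof.
rewrite /TK (iota_gt2 F); split=> [[/(EK_frame F) -> ->] //|/andP[/(EK_frame F) h ->]].
by [].
Qed.

Lemma TK_generator x : TK iota x -> <<1%VS; x>>%VS = fullv.
Proof.
case/TK_frame/andP=> /and3P[Zx x0 /forall_inP Hx] x2; apply/(frame_generator F) => i i0.
have /andP[_] := Hx i i0; rewrite ltr_norml => /andP[_ h].
by rewrite lt_eqF // (lt_trans h).
Qed.

(** Let [t] be the larger root of [X^2 - x X + 1]. If [y] is conjugate to [t], then [y + 1/y] is
    conjugate to [x]: either it equals [x] and [y] is [t] or [1/t], or it has absolute value below 2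
    and [y] lies on the unit circle. *)
Lemma TK_Salem_trace x : (0 < n)%N -> TK iota x -> Salem_trace (iota x).
Proof.
move=> n0 Tx; have := Tx => /TK_frame/andP[/and3P[Zx x0 /forall_inP Hx] x2].
pose r := e ord0 x; pose u : algR := (r + Num.sqrt (r ^+ 2 - 4)) / 2.
have u1 : 1 < u by have := sqrtr_ge0 (r ^+ 2 - 4); rewrite /u /r; lra.
have u0 : u != 0 by rewrite gt_eqF // (lt_trans ltr01).
have ru : r = u + u^-1.
  have h : Num.sqrt (r ^+ 2 - 4) ^+ 2 = r ^+ 2 - 4.
    by rewrite sqr_sqrtr // /r; nra.
  have q : u ^+ 2 - r * u + 1 = 0.
    by rewrite /u; move: (Num.sqrt _) h => y h; field: h.
  apply: (mulIf u0); rewrite mulrDl mulVf // -expr2.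
  by apply/eqP; rewrite eq_sym -subr_eq0 -q; apply/eqP; ring.
pose t : algC := algRval u.
have t0 : t != 0 by rewrite fmorph_eq0.
have Dx : iota x = t + t^-1.
  by rewrite (frame_iota F) -/r ru rmorphD fmorphV.
exists t; split=> //.
have [p [Dp p1] _] := minCpolyP (iota x).
have sp : size p = (size p).-1.+1 by rewrite prednK // size_poly_gt0 monic_neq0.
pose R := homog_poly (size p).-1 p ('X^2 + 1) 'X.
have RE (y : algC) : y != 0 ->
    root (map_poly ratr R) y = root (minCpoly (iota x)) (y + y^-1).
  move=> y0; rewrite /root homog_poly_horner ?map_polyX ?hornerX // -?sp //.
  rewrite mulf_eq0 expf_eq0 (negbTE y0) andbF /= -Dp; congr (_.[_] == 0).
  by rewrite rmorphD /= map_polyXn rmorph1 !hornerE; field.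
have Rt : root (map_poly ratr R) t by rewrite RE // -Dx root_minCpoly.
have R1 : R \is monic by apply: trace_poly_monic.
have At : t \in Aint.
  apply: (root_monic_Aint Rt); first by rewrite map_monic.
  have pint : p \is a polyOver Num.int.
    apply/polyOverP => i; rewrite -Cint_rat -coef_map -Dp.
    by have /polyOverP := Zx; apply.
  have Rint : R \is a polyOver Num.int.
    apply/polyOverP => i; rewrite coef_sum rpred_sum // => k _.
    rewrite coefZ rpredM ?(polyOverP pint) //.
    have -> : ('X^2 + 1) ^+ k * 'X ^+ ((size p).-1 - k) =
        map_poly intr (('X^2 + 1) ^+ k * 'X ^+ ((size p).-1 - k)) :> {poly rat}.
      by rewrite rmorphM !rmorphXn rmorphD /= map_polyXn rmorph1 map_polyX.
    by rewrite coef_map rpred_int.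
  by apply/polyOverP => i; rewrite coef_map Cint_rat (polyOverP Rint).
have t1 : 1 < t by exact: u1.
split=> //; first exact: algRvalP.
  move=> y ry yt.
  have y0 := conjugate_neq0 t0 ry.
  have /conjugate_frame : root (minCpoly (iota x)) (y + y^-1).
    by rewrite -RE // (root_dvdp (minCpoly_dvdp Rt)).
  move=> /(_ _ F)[i Hi]; have [i0|i0] := eqVneq i ord0.
    have : y + y^-1 = t + t^-1 by rewrite Hi i0 -(frame_iota F) Dx.
    case/trace_eq=> // [/eqP|->]; first by rewrite (negbTE yt).
    by rewrite normfV invf_le1 ?normr_gt0 // (le_trans (ltW t1)) // real_ler_norm // algRvalP.
  by rewrite (emb_trace_norm1 y0 (esym Hi)) //; have /andP[] := Hx i i0.
pose i : 'I_n.+1 := lift ord0 (Ordinal n0).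
have i0 : i != ord0 by [].
have /andP[_ xi2] := Hx i i0.
have [w w0 Hw] := trace_surj (algRval (e i x)).
have w1 := emb_trace_norm1 w0 Hw xi2.
exists w; split => //; last first.
  have tn : `|t| = t by rewrite gtr0_norm // (lt_trans ltr01 t1).
  by apply: contraTneq t1 => wt; rewrite -tn -wt w1 ltxx.
(* The minimal polynomial of [t] reduces to [c0 + c1 t = 0]. If [c1 = 0], it also vanishes at [w].
   Otherwise [t] is the image of some [z] in [L], and [x = z + 1/z] would have real conjugates of
   absolute value at least 2. *)
have [m [Dm _] _] := minCpolyP t.
have [c0 [c1 Hc]] := trace_remainder x m.
have := Hc iota t t0 Dx; rewrite -Dm (rootP (root_minCpoly t)) => E.
have [c10|c10] := eqVneq c1 0.
  move: E; rewrite c10 rmorph0 mul0r addr0 => /esym/eqP; rewrite fmorph_eq0 => /eqP c00.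
  by rewrite /conjugate /root Dm (Hc (ec i) w w0 Hw) c10 c00 !rmorph0 mul0r addr0.
pose z := - c0 / c1.
have Dz : iota z = t.
  rewrite rmorphM rmorphN fmorphV; apply: (mulIf (_ : iota c1 != 0)); first by rewrite fmorph_eq0.
  by rewrite mulfVK ?fmorph_eq0 // mulrC; apply/eqP; rewrite eq_sym -addr_eq0 addrC -E.
have z0 : z != 0 by rewrite -(fmorph_eq0 iota) Dz.
have : e i x = e i z + (e i z)^-1.
  rewrite -fmorphV -rmorphD; congr (e i _); apply: (fmorph_inj iota).
  by rewrite rmorphD fmorphV Dz.
by move=> h; move: xi2; rewrite h ltNge real_trace_ge2 // fmorph_eq0.
Qed.

(** A Salem number is conjugate to its inverse, so its minimal polynomial has zero remainder modulo
    [X^2 - x X + 1]. At another embedding, where [x] becomes [w + 1/w], both [w] and [1/w] are then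
    conjugates different from [t], of modulus at most 1, which forces [|w| = 1]. *)
Lemma Salem_trace_TK x : Salem_trace (iota x) -> <<1%VS; x>>%VS = fullv -> TK iota x.
Proof.
case=> t [[rt At t1 Ht [y [ry yt y1]]] Dx] /(frame_generator F) gen.
have t0 : t != 0 by rewrite gt_eqF // (lt_trans ltr01).
have rtV : root (minCpoly t) t^-1 := reciprocal_conjugate t0 ry y1.
have AtV : t^-1 \in Aint.
  by apply: (root_monic_Aint rtV); rewrite ?minCpoly_monic.
have x2 : 2 < e ord0 x.
  pose u : algR := in_algR rt.
  have u0 : u != 0 by rewrite -(fmorph_eq0 (algRval : {rmorphism _ -> _})).
  have u1 : 1 < u by exact: t1.
  have -> : e ord0 x = u + u^-1.
    by apply: val_inj; rewrite /= -(frame_iota F) Dx.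
  have h : u * u^-1 = 1 by rewrite mulfV.
  by move: (u^-1 : algR) h => v h; nra.
have xne (k : algR) : k <= 2 -> e ord0 x != k by move=> k2; rewrite gt_eqF // (le_lt_trans k2).
have [m [Dm _] _] := minCpolyP t.
have [c0 [c1 Hc]] := trace_remainder x m.
have := Hc iota t t0 Dx; rewrite -Dm (rootP (root_minCpoly t)) => E1.
have := Hc iota t^-1; rewrite invr_eq0 invrK addrC -Dm (rootP rtV) => /(_ t0 Dx) E2.
have tV : t - t^-1 != 0.
  rewrite subr_eq0; apply/eqP => h; have : t ^+ 2 == 1 by rewrite expr2 {1}h mulVf.
  by rewrite pexprn_eq1 ?(ltW (lt_trans ltr01 t1)) //= gt_eqF.
have c10 : c1 = 0.
  apply/eqP; rewrite -(fmorph_eq0 iota); apply/eqP/(mulIf tV); rewrite mul0r.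
  have -> : iota c1 * (t - t^-1) =
      (iota c0 + iota c1 * t) - (iota c0 + iota c1 * t^-1) by ring.
  by rewrite -E1 -E2 subrr.
move: E1; rewrite c10 rmorph0 mul0r addr0 => /esym/eqP; rewrite fmorph_eq0 => /eqP c00.
apply/TK_frame; rewrite x2 andbT; apply/and3P; split.
- by rewrite Dx rpredD.
- by rewrite (lt_trans _ x2).
apply/forall_inP => i i0.
have x0 : x != 0.
  by apply: contraTneq x2 => ->; rewrite rmorph0 ltrn0.
rewrite normr_gt0 fmorph_eq0 x0 /=.
have rw w : w != 0 -> algRval (e i x) = w + w^-1 -> `|w| <= 1.
  move=> w0 Hw; apply: Ht.
    by rewrite /conjugate /root Dm (Hc (ec i) w w0 Hw) c10 c00 !rmorph0 mul0r addr0.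
  apply: contraNneq (gen i i0) => wt; apply/eqP/val_inj => /=.
  by rewrite -(frame_iota F) Hw wt Dx.
have [w w0 Hw] := trace_surj (algRval (e i x)).
have w1 : `|w| = 1.
  apply/eqP; rewrite eq_le rw //=.
  have := rw w^-1; rewrite invr_eq0 invrK addrC => /(_ w0 Hw).
  by rewrite normfV invf_le1 ?normr_gt0.
apply: (emb_norm1_trace Hw w1).
  by apply: contraTneq x2 => ->; rewrite rmorph_nat ltxx.
by apply: contraTneq x2 => ->; rewrite rmorphN rmorph_nat; lra.
Qed.

End FrameSalem.

(** * Gaps between consecutive Pisot numbers *)

Lemma seq_argmin (R : realDomainType) (T : eqType) (f : T -> R) (s : seq T) x0 :
  x0 \in s -> exists2 x, x \in s & forall y, y \in s -> f x <= f y.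
Proof.
elim: s x0 => // a s IH x0 _; case: s IH => [|b s] IH.
  by exists a => [|y]; rewrite !inE // => /eqP ->.
have [x xs Hx] := IH b (mem_head _ _).
have [ax|xa] := leP (f a) (f x).
  exists a => [|y]; rewrite inE ?eqxx // => /orP[/eqP -> //|/Hx].
  exact: le_trans.
by exists x => [|y]; rewrite inE ?xs ?orbT // => /orP[/eqP -> |/Hx //]; apply: ltW.
Qed.

Section FrameGaps.
Variables (L : fieldExtType rat) (iota : {rmorphism L -> algC}) (n : nat).
Variable F : real_frame iota n.
Local Notation e := (frame_emb F).

Lemma frame0_inj : injective (e ord0).
Proof. exact: fmorph_inj. Qed.

Lemma ekb_gt0 x : ekb F x -> 0 < e ord0 x.
Proof. by case/and3P. Qed.

Lemma ekb_bounded x (B : algR) i : ekb F x -> e ord0 x <= B -> 2 <= B -> `|e i x| <= B.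
Proof.
case/and3P=> _ x0 /forall_inP Hx xB B2; have [->|i0] := eqVneq i ord0.
  by rewrite gtr0_norm.
by have /andP[_ /ltW h] := Hx i i0; apply: le_trans B2.
Qed.

(** Elements of [E_K] not exceeding a given one are bounded in every embedding, hence finite in
    number. *)
Lemma ekb_min (Q : pred L) x0 : (forall x, Q x -> ekb F x) -> Q x0 ->
  exists x, [/\ Q x, e ord0 x <= e ord0 x0 & forall y, Q y -> e ord0 x <= e ord0 y].
Proof.
move=> QE Q0; have [s Hs] := ZK_bounded_finite F (2 + e ord0 x0).
have x00 : 0 < e ord0 x0 by apply/ekb_gt0/QE.
pose s' := [seq x <- s | Q x & e ord0 x <= e ord0 x0].
have memS x : Q x -> e ord0 x <= e ord0 x0 -> x \in s'.
  move=> Qx xx0; rewrite mem_filter Qx xx0 /=; apply: Hs.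
    by have /and3P[] := QE x Qx.
  by move=> i; apply: ekb_bounded (QE x Qx) _ _; lra.
have [x] := seq_argmin (e ord0) (memS x0 Q0 (lexx _)).
rewrite mem_filter => /andP[/andP[Qx xx0] _] Hx.
exists x; split=> // y Qy; have [yx0|/ltW yx0] := leP (e ord0 y) (e ord0 x0).
  exact/Hx/memS.
exact: le_trans yx0.
Qed.

Lemma ekb_sub_pisot a b : pisotb F a -> pisotb F b -> e ord0 b < e ord0 a -> ekb F (a - b).
Proof.
move=> pa pb ab; apply/(EK_frame F)/(DK_EK F); exists a, b.
by split; rewrite ?(PisotK_frame F) ?(iota_lt F).
Qed.

Lemma FK_ekb x : FK iota x -> ekb F x.
Proof.
by case=> a [b] [pa pb ab Dx _]; apply/(EK_frame F)/(DK_EK F); exists a, b.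
Qed.

(** A Pisot number [c] strictly between [b] and [a] would split [a - b] as [(a - c) + (c - b)]. *)
Lemma FK_indecomposable x : ekb F x ->
  (forall y z, ekb F y -> ekb F z -> x != y + z) -> FK iota x.
Proof.
move=> /(EK_frame F)/(DK_EK F)[a [b [pa pb ab Dx]]] H; exists a, b; split=> // c pc.
rewrite !(iota_lt F) => -[bc ca].
have {pa pb pc} [pa pb pc] : [/\ pisotb F a, pisotb F b & pisotb F c].
  by split; apply/(PisotK_frame F).
have := H _ _ (ekb_sub_pisot pa pc ca) (ekb_sub_pisot pc pb bc).
by rewrite subrKA Dx eqxx.
Qed.

(** Summands of [v] in [E_K] are smaller than [v], hence equal to [u]; the only decomposition to
    exclude is [u + u]. *)
Lemma FK_second u v : ekb F u -> ekb F v -> u != v ->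
    (forall y, ekb F y -> e ord0 u <= e ord0 y) ->
    (forall y, ekb F y -> y != u -> e ord0 v <= e ord0 y) -> v != u + u ->
  rank_in iota (FK iota) v 1.
Proof.
move=> Eu Ev uv minu minv vuu.
have ltuv : e ord0 u < e ord0 v.
  by rewrite lt_neqAle minu // andbT; apply: contra uv => /eqP/frame0_inj ->.
have small y : ekb F y -> e ord0 y < e ord0 v -> y = u.
  by move=> Ey yv; apply/eqP; apply: contraTT yv => yu; rewrite -leNgt minv.
split.
  apply: FK_indecomposable => // y z Ey Ez; apply: contraNneq vuu => Dv.
  have y0 := ekb_gt0 Ey; have z0 := ekb_gt0 Ez.
  have yv : e ord0 y < e ord0 v by rewrite Dv rmorphD ltrDl.
  have zv : e ord0 z < e ord0 v by rewrite Dv rmorphD ltrDr.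
  by rewrite Dv (small y) // (small z).
exists [:: u]; split=> // y; rewrite inE (iota_lt F); split=> [/eqP ->|].
  split=> //; apply: FK_indecomposable => // a b Ea Eb; apply/eqP => Du.
  have := minu a Ea; rewrite Du rmorphD gerDl leNgt.
  by rewrite (ekb_gt0 Eb).
by case=> /FK_ekb Ey yv; apply/eqP/small.
Qed.

Lemma UK1 : UK iota 1.
Proof.
apply: (UK_of_bounds (F := F)); rewrite ?rmorph1 ?ltr01 //.
  by rewrite /ZK rmorph1 Aint1.
by move=> i; rewrite rmorph1 normr1; lra.
Qed.

Lemma ekb1 : ekb F 1.
Proof. by have /(UK_frame F)/andP[] := UK1. Qed.

Lemma ekb_least : exists u, [/\ ekb F u, e ord0 u <= 1 &
  forall y, ekb F y -> e ord0 u <= e ord0 y].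
Proof.
by have [|u [Eu u1 minu]] := ekb_min _ ekb1; [|exists u; rewrite rmorph1 in u1].
Qed.

Lemma FK_least u : ekb F u -> (forall y, ekb F y -> e ord0 u <= e ord0 y) ->
  rank_in iota (FK iota) u 0.
Proof.
move=> Eu minu; split.
  apply: FK_indecomposable => // a b Ea Eb; apply/eqP => Du.
  by have := minu a Ea; rewrite Du rmorphD gerDl leNgt (ekb_gt0 Eb).
exists [::]; split=> // y; split=> // -[/FK_ekb/minu]; rewrite (iota_lt F) leNgt.
by move=> /negbTE ->.
Qed.

Lemma ekb_double_ge2 u : ekb F u -> ekb F (u + u) -> 2 <= e ord0 (u + u).
Proof.
move=> Eu /and3P[_ _ /forall_inP Hv]; rewrite leNgt; apply/negP => v2.
have u0 := ekb_gt0 Eu; have /and3P[Zu _ _] := Eu.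
have := u0; rewrite (_ : u = 0) ?rmorph0 ?ltxx //.
apply: (ZK_small_eq0 (F := F)) => // i; have [->|i0] := eqVneq i ord0.
  by rewrite gtr0_norm //; rewrite rmorphD in v2; lra.
have /andP[_] := Hv i i0; rewrite rmorphD !ltr_norml => /andP[h1 h2].
by apply/andP; split; lra.
Qed.

Lemma frame_seq_gap (s : seq L) : exists2 delta : algR, 0 < delta <= 1 &
  forall b, b \in s -> b != 0 -> forall i, delta <= `|e i b|.
Proof.
elim: s => [|a s [del /andP[d0 d1] Hd]]; first by exists 1; rewrite ?ltr01 ?lexx.
pose del' := \big[Order.min/del]_i (if a == 0 then del else `|e i a|).
have le' : del' <= del by apply: bigmin_le_id.
exists del'.
  rewrite (le_trans le') // andbT; apply/bigmin_gtP; split=> // i _.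
  by case: ifP => // a0; rewrite normr_gt0 fmorph_eq0 a0.
move=> b; rewrite inE => /orP[/eqP -> a0 i|bs b0 i]; last exact: le_trans le' (Hd b bs b0 i).
by apply: le_trans (bigmin_le _ i _) _; rewrite (negbTE a0).
Qed.

(* A Pisot number whose conjugates are very close to [- S i] can only be followed by
   one that moves each of them in the direction of [S i], since all gaps have conjugates
   bounded away from [0]. *)
Lemma FK_sign (S : 'I_n.+1 -> algR) : (forall i, S i = 1 \/ S i = -1) ->
  exists f, FK iota f /\ forall i, i != ord0 -> 0 < S i * e i f.
Proof.
move=> HS; have half : 0 < 1 / 2 :> algR by lra.
(* [b0] bounds the gap in advance: [th + b0] will be Pisot for the [th] found below, so the list [s]
   and the separation [del] can be fixed before [th]. *)
have [b0 Zb0 [b00 Hb0]] := ZK_approximation F (fun i => S i / 2) 0 half.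
have [s Hs] := ZK_bounded_finite F (2 + e ord0 b0).
have [del /andP[d0 d1] Hd] := frame_seq_gap s.
have hd0 : 0 < del / 2 by lra.
(* Each other conjugate of [th] lies in (-1, 1) within [del] of [- S i]. A move by at least [del]
   against the sign [S i] would leave (-1, 1). *)
have [th Zth [th1 Hth]] := ZK_approximation F (fun i => - S i * (1 - del / 2)) 1 hd0.
have pth : pisotb F th.
  apply/and3P; split=> //; apply/forall_inP => i i0; have := Hth i i0.
  by rewrite !ltr_norml => /andP[h1 h2]; apply/andP; case: (HS i) h1 h2 => ->; split; lra.
have Eb0 : ekb F b0.
  apply/and3P; split=> //; apply/forall_inP => i i0; have := Hb0 i i0.
  rewrite normr_gt0 fmorph_eq0 !ltr_norml => /andP[h1 h2].
  rewrite (_ : b0 != 0) /=; last by apply: contraTneq b00 => ->; rewrite rmorph0 ltxx.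
  by apply/andP; case: (HS i) h1 h2 => ->; split; lra.
have pthb0 : pisotb F (th + b0).
  apply/and3P; split; first by rewrite rmorphD rpredD.
    by rewrite rmorphD; lra.
  apply/forall_inP => i i0; have := Hth i i0; have := Hb0 i i0.
  rewrite rmorphD !ltr_norml => /andP[h1 h2] /andP[h3 h4].
  by apply/andP; case: (HS i) h1 h2 h3 h4 => ->; split; lra.
have [||b [/andP[Eb pthb] bb0 minb]] :=
    @ekb_min (fun b => ekb F b && pisotb F (th + b)) b0.
- by move=> x /andP[].
- by rewrite Eb0.
exists b; split.
  exists (th + b), th; split; rewrite ?(PisotK_frame F) //.
  - by rewrite (iota_lt F) rmorphD ltrDl ekb_gt0.
  - by rewrite addrC addKr.
  move=> c /(PisotK_frame F) pc; rewrite !(iota_lt F) => -[thc cb].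
  have := minb (c - th); rewrite (ekb_sub_pisot pc pth thc) addrC subrK pc => /(_ isT).
  by rewrite rmorphB; rewrite rmorphD in cb; lra.
move=> i i0.
have bs : b \in s.
  apply: Hs; first by have /and3P[] := Eb.
  by move=> j; apply: ekb_bounded Eb _ _; lra.
have bn0 : b != 0 by apply: contraTneq (ekb_gt0 Eb) => ->; rewrite rmorph0 ltxx.
have := Hd b bs bn0 i; have := Hth i i0.
have /and3P[_ _ /forall_inP/(_ i i0)] := pthb.
rewrite rmorphD !ltr_norml ler_normr => /andP[h1 h2] /andP[h3 h4] /orP h5.
by case: (HS i) h3 h4 => -> h3 h4; case: h5 => h5; lra.
Qed.

(** A gap determines the signs of its conjugates, so different sign vectors give different gaps. *)
Lemma FK_many : exists s : seq L,
  [/\ uniq s, size s = (2 ^ n)%N & forall x, x \in s -> FK iota x].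
Proof.
pose sgn (ep : {ffun 'I_n -> bool}) (i : 'I_n.+1) : algR :=
  (* The sign at [ord0] is 1 by default; [FK_sign] constrains only the other embeddings. *)
  if unlift ord0 i is Some k then (-1) ^+ ep k else 1.
have sgnP ep i : sgn ep i = 1 \/ sgn ep i = -1.
  rewrite /sgn; case: unlift => [k|]; last by left.
  by case: (ep k); [right | left].
have /fin_all_exists[f Hf] ep := FK_sign (sgnP ep).
exists (codom f); split.
- rewrite map_inj_uniq ?enum_uniq // => ep ep' ff; apply/ffunP => k.
  have [_ H1] := Hf ep; have [_ H2] := Hf ep'.
  have := H1 (lift ord0 k) isT; have := H2 (lift ord0 k) isT.
  rewrite ff /sgn liftK; case: (ep k); case: (ep' k); rewrite ?expr0 ?expr1 //; lra.
- by rewrite size_codom card_ffun card_bool card_ord.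
by move=> x /codomP[ep ->]; have [] := Hf ep.
Qed.

Lemma TK_exists : exists x, ekb F x && (2 < e ord0 x).
Proof.
have half : 0 < 1 / 2 :> algR by lra.
have [x Zx [x2 Hx]] := ZK_approximation F (fun=> 1) 2 half.
exists x; rewrite x2 andbT; apply/and3P; split=> //; first by lra.
apply/forall_inP => i i0; have := Hx i i0.
rewrite normr_gt0 fmorph_eq0 !ltr_norml => /andP[h1 h2].
rewrite (_ : x != 0) /=; last by apply: contraTneq x2 => ->; rewrite rmorph0; lra.
by apply/andP; split; lra.
Qed.

(** The value 2 at [ord0] forces [x = 2], and then every other conjugate is 2; [n > 0] provides
    one. *)
Lemma ekb_neq2 x : (0 < n)%N -> ekb F x -> e ord0 x != 2.
Proof.
move=> n0 /and3P[_ _ /forall_inP Hx]; apply/eqP => x2.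
have {}x2 : x = 2 by apply: frame0_inj; rewrite rmorph_nat.
have /andP[_] := Hx (lift ord0 (Ordinal n0)) isT.
by rewrite x2 rmorph_nat ger0_norm ?ltxx // ler0n.
Qed.

End FrameGaps.

(** * The six statements for a totally real field *)

Theorem theorem1p3 (L : fieldExtType rat) (iota : {rmorphism L -> algC}) (d : nat)
  (hd : \dim {:L} = d) (hd2 : (2 <= d)%N)
  (htr : forall (s : {rmorphism L -> algC}) (x : L), s x \is Num.real) :
  (* (i) *)
  (forall x, DK iota x <-> EK iota x) /\
  (* (ii) *)
  (forall x, (UK iota x <-> EK iota x /\ 0 < iota x < 2) /\
             (UK iota x <-> DK iota x /\ 0 < iota x < 2)) /\
  (* (iii) *)
  ((forall x, TK iota x <-> DK iota x /\ 2 < iota x) /\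
   (forall x, DK iota x <-> TK iota x \/ UK iota x) /\
   (forall x, ~ (TK iota x /\ UK iota x)) /\
   (forall x, TK iota x -> degK x = d)) /\
  (* (iv) *)
  (exists s : seq L, [/\ uniq s, size s = (2 ^ d.-1)%N & forall x, x \in s -> FK iota x]) /\
  (* (v) *)
  ((forall x, FK iota x -> 0 < iota x < 2 -> UK iota x) /\
   (exists x, [/\ rank_in iota (FK iota) x 0, rank_in iota (UK iota) x 0 & iota x <= 1]) /\
   ((exists a b, [/\ UK iota a, UK iota b & a != b]) ->
      exists x, rank_in iota (FK iota) x 1 /\ rank_in iota (UK iota) x 1)) /\
  (* (vi) *)
  ((exists u, forall y, UK iota y <-> y = u) ->
     rank_in iota (FK iota) 1 0 /\
     exists t, [/\ is_min iota (TK iota) t, rank_in iota (FK iota) t 1 &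
                   is_min iota (fun y => Salem_trace (iota y) /\ degK y = d) t]).
Proof.
have [n [F]] := real_frame_exists iota htr.
have dn : d = n.+1 by rewrite -hd (frame_dim F).
have n0 : (0 < n)%N by rewrite dn in hd2.
rewrite {d hd hd2}dn /=.
have DE := DK_EK F.
have EF := EK_frame F.
have UF := UK_frame F.
have TF := TK_frame F.
have UE x : UK iota x <-> EK iota x /\ 0 < iota x < 2.
  rewrite (iota_gt0 F) (iota_lt2 F); split=> [/UF/andP[Ex x2]|[/EF Ex /andP[_ x2]]].
    by split; [apply/EF | rewrite x2 (ekb_gt0 Ex)].
  by apply/UF/andP.
have [u [Eu u1 minu]] := ekb_least F.
have Uu : UK iota u by apply/UF; rewrite Eu /=; lra.
have Fu := FK_least Eu minu.
split=> //; split; [|split; [|split; [|split]]].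
- by move=> x; split; [exact: UE | rewrite DE; exact: UE].
- split; [|split; [|split]] => x.
  + by rewrite DE.
  + rewrite DE; split=> [/EF Ex|[[]//|/UE[]//]].
    have [x2|x2|x2] := ltgtP (frame_emb F ord0 x) 2.
    * by right; apply/UF; rewrite Ex.
    * by left; apply/TF; rewrite Ex.
    * by have := ekb_neq2 n0 Ex; rewrite x2 eqxx.
  + by case=> /TF/andP[_ h1] /UF/andP[_ h2]; lra.
  + by move/(TK_generator F)/(degK_generator F).
- exact: FK_many.
- split; [|split].
  + by move=> x /(FK_ekb F)/EF Ex x2; apply/UE.
  + exists u; split=> //; last by rewrite -(rmorph1 iota) (iota_le F) rmorph1.
    split=> //; exists [::]; split=> // y; split=> // -[/UF/andP[/minu h _]].
    by rewrite (iota_lt F); lra.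
  case=> a [b [Ua Ub ab]].
  have [c Uc cu] : exists2 c, UK iota c & c != u.
    have [au|au] := eqVneq a u; last by exists a.
    by exists b; rewrite // -au eq_sym.
  have /UF/andP[Ec c2] := Uc.
  (* [v] is the second smallest element of [E_K]. The competitor [c] keeps it below 2, so it lies in
     [U_K] and is second in both sets. *)
  have [||v [/andP[Ev vu] vc minv]] := @ekb_min _ _ _ F (fun x => ekb F x && (x != u)) c.
  * by move=> x /andP[].
  * by rewrite Ec.
  have v2 := le_lt_trans vc c2.
  have Uv : UK iota v by apply/UF; rewrite Ev.
  have Fv : rank_in iota (FK iota) v 1.
    apply: (FK_second Eu Ev) => //; first by rewrite eq_sym.
      by move=> y Ey yu; apply: minv; rewrite Ey.
    by apply: contraTneq v2 => vuu; rewrite -leNgt vuu; apply: ekb_double_ge2; rewrite -?vuu.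
  exists v; split=> //; split=> //; exists [:: u]; split=> // y; rewrite inE (iota_lt F).
  split=> [/eqP ->|[/UF/andP[Ey _] yv]].
    split=> //; rewrite lt_neqAle minu // andbT.
    by apply: contraNneq vu => /frame0_inj ->.
  by apply: contraTT yv => yu; rewrite -leNgt minv // Ey.
case=> u' Hu'.
have u1E : u = 1.
  by have /Hu' -> := Uu; have /Hu' -> := UK1 F.
subst u; split=> //.
(* Elements of [E_K] differ from 2, and those below 2 form [U_K], which is now the singleton of 1.
   So [T_K] is [E_K] without 1, and its minimum is the second smallest element of [E_K]. *)
have TE x : TK iota x <-> ekb F x && (x != 1).
  split=> [/TF/andP[Ex x2]|/andP[Ex x1]].
    by rewrite Ex; apply: contraTneq x2 => ->; rewrite rmorph1; lra.
  apply/TF; rewrite Ex lt_neqAle eq_sym ekb_neq2 //= leNgt; apply: contra x1 => x2.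
  have /Hu' -> : UK iota x by apply/UF; rewrite Ex.
  by apply/eqP/esym/Hu'/(UK1 F).
have [c /TF/TE Tc] := TK_exists F.
have [||t [Tt _ mint]] := @ekb_min _ _ _ F (fun x => ekb F x && (x != 1)) c => //.
  by move=> x /andP[].
have /andP[Et t1] := Tt.
have TKt : TK iota t by apply/TE.
have tmin : is_min iota (TK iota) t.
  by split=> // y /TE Ty; rewrite (iota_le F) mint.
have SE y : Salem_trace (iota y) /\ degK y = n.+1 <-> TK iota y.
  split=> [[Sy /(degK_generator F) gy]|Ty]; first exact: (Salem_trace_TK F).
  split; first exact: (TK_Salem_trace F).
  exact/(degK_generator F)/(TK_generator F).
exists t; split=> //.
  apply: (FK_second Eu Et) => //; first by rewrite eq_sym.
    by move=> y Ey y1; apply: mint; rewrite Ey.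
  (* The decomposition [1 + 1] has value 2, while [t] exceeds 2. *)
  have /TF/andP[_] := TKt; apply: contraTneq => ->.
  by rewrite rmorphD rmorph1 ltxx.
by split=> [|y /SE /tmin.2 //]; apply/SE.
Qed.
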